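(* Let $m,n$ be positive integers. For a face $F$ of $\textit{PASM}(m,n)$ (including the empty face), let $\mathcal{M}(F)$ be the set of partial alternating sign matrices that are vertices of $F$, and let $\psi(F)=g(\mathcal{M}(F))$. Then $\psi$ is an isomorphism between the face lattice of $\textit{PASM}(m,n)$ (ordered by inclusion) and the set of sum-labelings of $\Gamma_{(m,n)}$ ordered by containment. Moreover, for every face $F$, $\dim F=\mathcal{R}(\psi(F))$ (with $\dim\emptyset=-1$).
   Context: An $m\times n$ partial alternating sign matrix (PASM) is an $m\times n$ matrix $M$ with entries in $\{-1,0,1\}$ all of whose column partial sums $\sum_{i'=1}^{i}M_{i'j}$ and row partial sums $\sum_{j'=1}^{j}M_{ij'}$ ($1\le i\le m$, $1\le j\le n$) lie in $\{0,1\}$. $\textit{PASM}(m,n)\subseteq\mathbb{R}^{mn}$ is the convex hull of all $m\times n$ PASMs (its vertices are exactly the PASMs). The grid graph $\Gamma_{(m,n)}$ has vertices $(i,j)$, $1\le i\le m+1$, $1\le j\le n+1$; vertices with $i\le m$ and $j\le n$ are internal, those with $i=m+1$ or $j=n+1$ are boundary vertices. Its edges are, for $1\le i\le m$, $1\le j\le n$: the edge $(i,j)$–$(i,j+1)$ and the edge $(i,j)$–$(i+1,j)$. It is drawn in the plane as a grid, vertex $(i,j)$ in row $i$ (rows going down) and column $j$ (columns going right). Given a PASM $M$, its basic sum-labeling $g(M)$ labels the edge $(i,j)$–$(i,j+1)$ by the row partial sum $\sum_{j'=1}^{j}M_{ij'}$ and the edge $(i,j)$–$(i+1,j)$ by the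 column partial sum $\sum_{i'=1}^{i}M_{i'j}$. View labels as sets: a label $0$ or $1$ is the set $\{0\}$ or $\{1\}$. The union of two labelings labels each edge by the union of its two labels; containment $\delta\subseteq\delta'$ means each edge label of $\delta$ is a subset of the corresponding label of $\delta'$. A sum-labeling of $\Gamma_{(m,n)}$ is either the empty labeling $\emptyset$ (contained in every sum-labeling) or a union of a nonempty set of basic sum-labelings (so each edge is labeled $0$, $1$, or $\{0,1\}$). For a set $\mathcal{M}$ of PASMs, $g(\mathcal{M})=\bigcup_{M\in\mathcal{M}}g(M)$, and $g(\emptyset)$ is the empty labeling. Regions: for a nonempty sum-labeling $\delta$, let $G$ be the plane graph formed by the edges labeled $\{0,1\}$ together with their endpoints, where all boundary vertices (on the right and bottom) are identified to a single point lying in the exterior of the grid. A region of $\delta$ is a face of this plane graph other than the exterior (unbounded) one; $\mathcal{R}(\delta)$ is the number of regions, and $\mathcal{R}(\emptyset)=-1$. *)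

(* Defs.v *)
From HB Require Import structures.
From mathcomp Require Import all_boot all_order all_algebra.
From mathcomp Require Import finmap.
From mathcomp Require Import mathcomp_extra boolp classical_sets functions.
From mathcomp Require Import set_interval cardinality reals topology normedtype.
From mathcomp Require Import convex.

Set Implicit Arguments.
Unset Strict Implicit.
Unset Printing Implicit Defensive.

Import Order.TTheory GRing.Theory Num.Theory.
Import numFieldNormedType.Exports.
Local Open Scope classical_set_scope.
Local Open Scope ring_scope.

(* Indices are 0-based: the 1-based row i and column j of the mathematics are
   the ordinals i - 1 and j - 1. *)

Section Polytopes.
Context {R : realType} {m n : nat}.
Implicit Types (P F : set 'M[R]_(m, n)).

Definition convex_hull P : set 'M[R]_(m, n) :=
  smallest (@convex_set R 'M[R]_(m, n)) P.

Definition mxdot (c x : 'M[R]_(m, n)) : R := \sum_i \sum_j c i j * x i j.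

(* The functional c = 0 is allowed: the bounds 0 and 1 then give the faces P
   and set0. *)
Definition face P F : Prop :=
  exists (c : 'M[R]_(m, n)) (b : R),
    (forall x, P x -> mxdot c x <= b) /\ F = P `&` [set x | mxdot c x = b].

Definition vertex_of P (x : 'M[R]_(m, n)) : Prop := face P [set x].

Definition affinely_independent k (x : 'I_k -> 'M[R]_(m, n)) : Prop :=
  forall a : 'I_k -> R,
    \sum_i a i = 0 -> \sum_i a i *: x i = 0 -> forall i, a i = 0.

(* The maximal number of affinely independent points, minus one; it is -1 for
   the empty set.  An affinely independent family in R^(mn) has at most mn + 1
   members, so the bound on k loses nothing. *)
Definition affine_dim F : int :=
  (\max_(k < (m * n).+2 |
      `[< exists x : 'I_k -> 'M[R]_(m, n),
            affinely_independent x /\ forall i, F (x i) >]) k)%N%:Z - 1.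

End Polytopes.

Section PartialASM.
Context {R : realType} {m n : nat}.
Implicit Types (M : 'M[R]_(m, n)).

Definition row_psum M (i : 'I_m) (j : 'I_n) : R :=
  \sum_(j' < n | (j' <= j)%N) M i j'.

Definition col_psum M (i : 'I_m) (j : 'I_n) : R :=
  \sum_(i' < m | (i' <= i)%N) M i' j.

Definition pasm M : Prop :=
  forall i j, [/\ M i j \in [:: -1; 0; 1],
                  row_psum M i j \in [:: 0; 1] &
                  col_psum M i j \in [:: 0; 1]].

End PartialASM.

Definition PASM (R : realType) (m n : nat) : set 'M[R]_(m, n) :=
  convex_hull [set M | pasm M].
Arguments PASM : clear implicits.

(* inl (i, j) is the edge (i, j) -- (i, j + 1),
   inr (i, j) is the edge (i, j) -- (i + 1, j). *)
Definition edge (m n : nat) := ('I_m * 'I_n + 'I_m * 'I_n)%type.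

Definition vertex (m n : nat) := ('I_m.+1 * 'I_n.+1)%type.

Section GridGraph.
Context {m n : nat}.

Definition internal (v : vertex m n) : bool := (v.1 < m)%N && (v.2 < n)%N.

Definition tail (e : edge m n) : vertex m n :=
  match e with
  | inl (i, j) | inr (i, j) =>
      (widen_ord (leqnSn m) i, widen_ord (leqnSn n) j)
  end.

Definition head (e : edge m n) : vertex m n :=
  match e with
  | inl (i, j) => (widen_ord (leqnSn m) i, lift ord0 j)
  | inr (i, j) => (lift ord0 i, widen_ord (leqnSn n) j)
  end.

End GridGraph.

Section SumLabelings.
Context {R : realType} {m n : nat}.

Definition labeling := edge m n -> set R.
Implicit Types (d : labeling) (MM : set 'M[R]_(m, n)).

Definition basic_sum_labeling (M : 'M[R]_(m, n)) : labeling := fun e =>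
  match e with
  | inl (i, j) => [set row_psum M i j]
  | inr (i, j) => [set col_psum M i j]
  end.

(* On the empty set of matrices, every label is empty. *)
Definition labeling_of MM : labeling :=
  fun e => \bigcup_(M in MM) basic_sum_labeling M e.

Definition empty_labeling : labeling := fun=> set0.

Definition sum_labeling d : Prop :=
  d = empty_labeling \/
  exists MM, [/\ MM !=set0, MM `<=` [set M | pasm M] & d = labeling_of MM].

Definition labeling_sub d d' : Prop := forall e, d e `<=` d' e.

Definition pasm_vertices (F : set 'M[R]_(m, n)) : set 'M[R]_(m, n) :=
  [set M | pasm M /\ vertex_of F M].

Definition psi (F : set 'M[R]_(m, n)) : labeling :=
  labeling_of (pasm_vertices F).

(* First coordinate: row, growing downwards; second coordinate: column,
   growing to the right. *)
Notation plane := (R^o * R^o)%type.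

Definition segment (p q : plane) : set plane :=
  [set p + t *: (q - p) | t in `[0, 1]%classic].

Definition position (v : vertex m n) : plane := (v.1%:R, v.2%:R).

(* The point to which all boundary vertices are identified; it lies beyond the
   lower right corner of the grid. *)
Definition outer_point : plane := (m.+1%:R, n.+1%:R).

(* An edge ending at a boundary vertex is prolonged, by a segment outside the
   grid, from the position of that vertex in the grid to outer_point.  The
   segments from outer_point to the points of the right and bottom sides of the
   grid meet the grid only at those points and each other only at outer_point,
   so this draws the graph with identified boundary vertices without
   crossings. *)
Definition edge_arc (e : edge m n) : set plane :=
  segment (position (tail e)) (position (head e)) `|`
  (if internal (head e) then set0
   else segment (position (head e)) outer_point).

Definition drawing d : set plane :=
  \bigcup_(e in [set e | d e = [set 0; 1]]) edge_arc e.

(* The faces of a plane graph are the connected components of the complement of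
   its drawing; the exterior one is the unbounded one. *)
Definition regions d : set (set plane) :=
  [set C | (exists2 p, ~ drawing d p &
                       C = connected_component (~` drawing d) p)
           /\ bounded_set C].

(* The cardinal of fset_set A is that of A only when A is finite. *)
Definition num_regions d : int :=
  if `[< d = empty_labeling >] then -1
  else #|` fset_set (regions d)|%:Z.

End SumLabelings.

Arguments labeling : clear implicits.
Arguments sum_labeling {R m n}.

(* Main.v *)
(* A partial alternating sign matrix is encoded by its corner sums, a potential
   on the regions cut out by the full grid graph whose differences across the
   edges are the row and column partial sums.  Rounding the potential down shows
   that PASM(m,n) is the polytope where all partial sums lie in [0, 1], so a face
   is determined by the edges on which its partial sums are constantly 0 or
   constantly 1.  Moving inside a face means changing the potential by a function
   that is constant across those edges and 0 on the exterior; hence the dimension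
   is the number of classes of cells, joined across the edges not labeled {0,1},
   that do not contain the exterior.  These classes are exactly the bounded
   components of the complement of the drawing: every cell is star-shaped (the
   exterior is a union of half planes), and two closed cells meeting outside the
   drawing belong to the same class. *)
From HB Require Import structures.
Require Import Defs.
From mathcomp Require Import all_boot all_order all_algebra.
From mathcomp Require Import boolp classical_sets functions cardinality reals.
From mathcomp Require Import finmap interval_inference topology normedtype convex.
From mathcomp Require Import zify ring lra.

Set Implicit Arguments.
Unset Strict Implicit.
Unset Printing Implicit Defensive.

Import Order.TTheory GRing.Theory Num.Theory.
Import numFieldNormedType.Exports.
Local Open Scope classical_set_scope.
Local Open Scope ring_scope.

(** * Corner sums *)

Section Telescoping.
Context {k : nat}.

(** [None] at index 0 becomes, through [omap] in [lo], the exterior cell. *)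
Definition opred (i : 'I_k) : option 'I_k :=
  if (0 < i)%N then insub i.-1 else None.

Variant opred_spec (i : 'I_k) : option 'I_k -> Type :=
| OpredNone of i = 0%N :> nat : opred_spec i None
| OpredSome (i' : 'I_k) of i = i'.+1 :> nat : opred_spec i (Some i').

Lemma opredP i : opred_spec i (opred i).
Proof.
rewrite /opred; case: posnP => [i0|i0]; first by constructor.
case: insubP => [i' _ i'E|]; first by constructor; rewrite i'E prednK.
by rewrite -leqNgt leqNgt (leq_ltn_trans (leq_pred _)).
Qed.

Lemma opred_succ (i i' : 'I_k) : i' = i.+1 :> nat -> opred i' = Some i.
Proof.
case: opredP => [-> //|j ->] [ji]; congr Some; exact/val_inj.
Qed.

Lemma big_ord_le_opred (V : zmodType) (g : 'I_k -> V) (i : 'I_k) :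
  \sum_(j < k | (j <= i)%N) g j
  = g i + oapp (fun i' : 'I_k => \sum_(j < k | (j <= i')%N) g j) 0 (opred i).
Proof.
rewrite (bigD1 i) //=; congr (_ + _); case: opredP => [i0|i' iE] /=.
  by apply: big_pred0 => j; rewrite -val_eqE /=; lia.
by apply: eq_bigl => j; rewrite -val_eqE /=; lia.
Qed.

Lemma sum_telescope (V : zmodType) (g : 'I_k -> V) (i : 'I_k) :
  \sum_(j < k | (j <= i)%N) (g j - oapp g 0 (opred j)) = g i.
Proof.
case: i => i; elim: i => [|i IH] ik; rewrite big_ord_le_opred.
  by case: opredP => [|//] _ /=; rewrite subr0 addr0.
rewrite (@opred_succ (Ordinal (ltnW ik))) //= IH ?(ltnW ik) // => ik'.
by rewrite (bool_irrelevance ik' (ltnW ik)) subrK.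
Qed.

End Telescoping.

(* The regions cut out by the full grid graph: [Some (i, j)] is the one with
   upper left corner at the vertex (i, j), [None] is the exterior. *)
Definition cell (m n : nat) := option ('I_m * 'I_n).

(** * Edge sums as differences of corner sums *)

Section Heights.
Context {R : realType} {m n : nat}.
Implicit Types (x y M : 'M[R]_(m, n)) (e : edge m n) (c : cell m n).

(* [hi e] is the cell below or to the right of e, [lo e] the one above or to
   its left. *)
Definition hi e : cell m n := match e with inl p | inr p => Some p end.

Definition lo e : cell m n :=
  match e with
  | inl (i, j) => omap (fun i' => (i', j)) (opred i)
  | inr (i, j) => omap (fun j' => (i, j')) (opred j)
  end.

Definition edge_sum e x : R :=
  match e with
  | inl (i, j) => row_psum x i j
  | inr (i, j) => col_psum x i j
  end.

(* The corner-sum matrix, as a potential on the cells whose differences across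
   the edges are the edge sums. *)
Definition height c x : R :=
  if c is Some (i, j)
  then \sum_(i' < m | (i' <= i)%N) \sum_(j' < n | (j' <= j)%N) x i' j'
  else 0.

Lemma edge_sum_height x e : edge_sum e x = height (hi e) x - height (lo e) x.
Proof.
case: e => [[i j]|[i j]] /=.
  by rewrite big_ord_le_opred /row_psum; case: opredP => [_|i' _] /=; ring.
have -> : col_psum x i j =
    \sum_(i' < m | (i' <= i)%N) (\sum_(j' < n | (j' <= j)%N) x i' j' -
     oapp (fun j0 : 'I_n => \sum_(j' < n | (j' <= j0)%N) x i' j') 0 (opred j)).
  by apply: eq_bigr => i' _; rewrite big_ord_le_opred addrK.
rewrite sumrB; congr (_ - _); case: opredP => [_|j' _] //=.
by rewrite big1.
Qed.

Fact edge_sum_is_linear e : scalar (edge_sum e).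
Proof.
move=> a x y; case: e => [[i j]|[i j]] /=;
  rewrite /row_psum /col_psum mulr_sumr -big_split /=;
  by apply: eq_bigr => k _; rewrite !mxE.
Qed.

Fact height_is_linear c : scalar (height c).
Proof.
move=> a x y; case: c => [[i j]|] /=; last by rewrite mulr0 addr0.
rewrite mulr_sumr -big_split /=; apply: eq_bigr => i' _.
rewrite mulr_sumr -big_split /=; apply: eq_bigr => j' _; by rewrite !mxE.
Qed.

Fact mxdot_is_linear (w : 'M[R]_(m, n)) : scalar (mxdot w).
Proof.
move=> a x y; rewrite /mxdot mulr_sumr -big_split /=; apply: eq_bigr => i _.
rewrite mulr_sumr -big_split /=; apply: eq_bigr => j _; rewrite !mxE; ring.
Qed.

Lemma entry_edge_sum x i j : x i j = edge_sum (inl (i, j)) x -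
  oapp (fun j' : 'I_n => edge_sum (inl (i, j')) x) 0 (opred j).
Proof. by rewrite /= /row_psum big_ord_le_opred addrK. Qed.

Lemma edge_sum_inj x y : edge_sum^~ x =1 edge_sum^~ y -> x = y.
Proof.
move=> /= exy; apply/matrixP => i j; rewrite !entry_edge_sum exy.
by congr (_ - _); case: (opred j) => [j'|] //; exact: exy (inl _).
Qed.

Lemma height_inj x y : height^~ x =1 height^~ y -> x = y.
Proof. by move=> /= hxy; apply: edge_sum_inj => e; rewrite !edge_sum_height !hxy. Qed.

(** The mixed second difference of f; taking corner sums undoes it once f vanishes on the
    exterior. *)
Definition of_height (f : cell m n -> R) : 'M[R]_(m, n) :=
  \matrix_(i, j) (f (Some (i, j)) - f (lo (inl (i, j)))
     - oapp (fun j' => f (Some (i, j')) - f (lo (inl (i, j')))) 0 (opred j)).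

Lemma of_heightK (f : cell m n -> R) : f None = 0 -> height^~ (of_height f) =1 f.
Proof.
move=> f0 [[i j]|] //=.
transitivity (\sum_(i' < m | (i' <= i)%N)
    (f (Some (i', j)) - oapp (fun k => f (Some (k, j))) 0 (opred i'))).
  apply: eq_bigr => i' _.
  rewrite (eq_bigr _ (fun j' _ => mxE _ _ _ j')).
  rewrite (sum_telescope (fun j' => f (Some (i', j')) - f (lo (inl (i', j'))))).
  by rewrite /=; case: (opred i') => [?|] /=; rewrite ?f0.
exact: (sum_telescope (fun k => f (Some (k, j)))).
Qed.

Lemma edge_sum_of_height (f : cell m n -> R) e : f None = 0 ->
  edge_sum e (of_height f) = f (hi e) - f (lo e).
Proof. by move=> f0; rewrite edge_sum_height !of_heightK. Qed.

End Heights.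

HB.instance Definition _ (R : realType) m n (e : edge m n) :=
  GRing.isLinear.Build R 'M[R]_(m, n) R^o *%R (edge_sum e)
    (edge_sum_is_linear e).
HB.instance Definition _ (R : realType) m n (c : cell m n) :=
  GRing.isLinear.Build R 'M[R]_(m, n) R^o *%R (height c)
    (height_is_linear c).
HB.instance Definition _ (R : realType) m n (w : 'M[R]_(m, n)) :=
  GRing.isLinear.Build R 'M[R]_(m, n) R^o *%R (mxdot w)
    (mxdot_is_linear w).

(** * The polytope and its faces *)

Section Box.
Context {R : realType} {m n : nat}.
Implicit Types (x y M : 'M[R]_(m, n)) (e : edge m n) (c : cell m n).

Definition box : set 'M[R]_(m, n) := [set x | forall e, 0 <= edge_sum e x <= 1].

(** An entry is the difference of two consecutive row partial sums, so partial sums in {0, 1} give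
    entries in {-1, 0, 1}. *)
Lemma pasmP M : pasm M <-> forall e, edge_sum e M \in [:: 0; 1].
Proof.
split=> [pM [[i j]|[i j]]|eM i j]; [by case: (pM i j)..|].
have [r c] := (eM (inl (i, j)), eM (inr (i, j))); split=> //.
rewrite entry_edge_sum; case: (opred j) => [j'|] /=; last first.
  by rewrite subr0; move: r; rewrite /= !inE => /orP[] /eqP ->; rewrite eqxx ?orbT.
move: r (eM (inl (i, j'))); rewrite /= !inE.
by move=> /orP[] /eqP -> /orP[] /eqP ->; rewrite ?subrr ?subr0 ?sub0r ?eqxx ?orbT.
Qed.

Lemma pasm_box M : pasm M -> box M.
Proof.
by move=> /pasmP pM e; have := pM e; rewrite !inE => /orP[] /eqP ->;
  rewrite ?lexx ?ler01.
Qed.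

Lemma edge_sum_comb e (a b : R) x y :
  edge_sum e (a *: x + b *: y) = a * edge_sum e x + b * edge_sum e y.
Proof. by rewrite linearP /= linearZ_LR. Qed.

Lemma box_comb x y (t : R) : 0 <= t <= 1 -> box x -> box y ->
  box ((1 - t) *: x + t *: y).
Proof.
move=> t01 bx by_ e; rewrite edge_sum_comb.
by have := bx e; have := by_ e; nra.
Qed.

Let frac (r : R) : R := r - (Num.floor r)%:~R.

Let frac_itv r : 0 <= frac r < 1.
Proof.
have /andP[] := floor_itv r; rewrite /frac intrD; move=> *; lra.
Qed.

(** Rounding down turns a difference in [0, 1] into 0 or 1. The order of the fractional parts
    recorded in each case is what survives rescaling them. *)
Lemma floor_step (r s : R) : 0 <= r - s <= 1 ->
  (Num.floor r = Num.floor s /\ frac s <= frac r) \/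
  (Num.floor r = Num.floor s + 1 /\ frac r <= frac s).
Proof.
move=> rs; have fr := frac_itv r; have fs := frac_itv s.
have [l1 l2] : (Num.floor s <= Num.floor r) /\ (Num.floor r < Num.floor s + 2).
  split; first by apply: le_floor; lra.
  by rewrite -(ltr_int R) intrD; move: fr fs; rewrite /frac; lra.
have [E|E] : Num.floor r = Num.floor s \/ Num.floor r = Num.floor s + 1 by lia.
  by left; split=> //; move: rs; rewrite /frac E; lra.
by right; split=> //; move: rs; rewrite /frac E intrD; lra.
Qed.

(* A point x of the box that is not integral lies on a segment from the
   rounding M of its heights to the point y where its fractional parts are
   rescaled so that the largest one becomes 1; y has more integral heights. *)
Lemma box_ind (Q : 'M[R]_(m, n) -> Prop) :
  (forall M, pasm M -> Q M) ->
  (forall M y t, pasm M -> box y -> Q M -> Q y -> 0 < t < 1 ->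
     Q ((1 - t) *: M + t *: y)) ->
  forall x, box x -> Q x.
Proof.
move=> Qpasm Qcomb x; pose nonint (x : 'M[R]_(m, n)) :=
  [set c : cell m n | frac (height c x) != 0]%SET.
have [k] := ubnP #|nonint x|; elim: k x => // k IH x /ltnSE xk bx.
pose f c := Num.floor (height c x); pose g c := frac (height c x).
have f0 : (f None)%:~R = 0 :> R by rewrite /f /= floor0.
have step e : (f (hi e) = f (lo e) /\ g (lo e) <= g (hi e)) \/
  (f (hi e) = f (lo e) + 1 /\ g (hi e) <= g (lo e)).
  by have := bx e; rewrite edge_sum_height => /floor_step.
pose M := of_height (fun c => (f c)%:~R : R).
have pM : pasm M.
  apply/pasmP => e; rewrite edge_sum_of_height // -intrB.
  by have [[-> _]|[-> _]] := step e; rewrite ?subrr ?[_ + 1]addrC ?addrK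
    !inE eqxx ?orbT.
pose c0 := [arg max_(c > None) g c]%O.
have g_max c : g c <= g c0.
  by rewrite /c0; case: Order.TotalTheory.arg_maxP => // i _ /(_ c isT).
have [g0 _] := andP (frac_itv (height c0 x)); rewrite -/(g c0) in g0.
have gE c : height c x = (f c)%:~R + g c by rewrite /g /frac addrC subrK.
have [gc0|gc0] := eqVneq (g c0) 0.
  suff -> : x = M by exact: Qpasm.
  apply: height_inj => c /=; rewrite of_heightK // gE.
  by have := frac_itv (height c x); have := g_max c; rewrite gc0 /g; lra.
have {gc0}g0 : 0 < g c0 by rewrite lt0r gc0.
have g1 : g c0 < 1 by case/andP: (frac_itv (height c0 x)).
pose h c := (f c)%:~R + g c / g c0.
have h0 : h None = 0 by rewrite /h f0 /g /frac /= floor0 subrr mul0r addr0.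
pose y := of_height h.
have -> : x = (1 - g c0) *: M + g c0 *: y.
  apply: height_inj => c /=.
  rewrite linearP /= linearZ_LR /= !of_heightK // gE /h.
  by field; rewrite gt_eqF.
(* Rescaling keeps the order of the fractional parts, which by [step] keeps the differences in
   [0, 1]. *)
have by_ : box y.
  move=> e; rewrite edge_sum_of_height // /h.
  have gg c : 0 <= g c / g c0 <= 1.
    have /andP[gc _] := frac_itv (height c x).
    by rewrite divr_ge0 ?(ltW g0) //= ler_pdivrMr ?mul1r.
  have gle c c' : g c <= g c' -> g c / g c0 <= g c' / g c0.
    by move=> ?; rewrite ler_pM2r ?invr_gt0.
  have := gg (hi e); have := gg (lo e).
  by have [[-> /gle]|[-> /gle]] := step e; rewrite ?intrD; lra.
apply: Qcomb => //; [exact: Qpasm| |by rewrite g0 g1].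
apply: IH => //; apply: leq_trans xk; apply: proper_card.
have hint c : g c = 0 \/ c = c0 -> frac (height c y) = 0.
  rewrite of_heightK // /h /frac; case=> [->|->].
    by rewrite mul0r addr0 intrKfloor subrr.
  by rewrite divff ?gt_eqF // -[1 in LHS]/(1%:~R) -intrD intrKfloor subrr.
apply/fintype.properP; split.
  apply/fintype.subsetP => c; rewrite !inE; apply: contraNneq => gc.
  by apply/eqP/hint; left.
by exists c0; rewrite !inE ?hint ?eqxx ?gt_eqF //; right.
Qed.

(** The box is convex and contains the PASMs; conversely [box_ind] builds each of its points from
    PASMs by convex combinations. *)
Lemma PASM_box : PASM R m n = box.
Proof.
apply/seteqP; split.
  apply: smallest_sub => [x y t /set_mem bx /set_mem by_|M]; last exact: pasm_box.
  apply: mem_set.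
  (* [conv t] gives the weight t to the first point, [box_comb] to the second. *)
  have -> : conv t x y = (1 - (1 - t%:num)) *: (x : 'M[R]_(m, n)) + (1 - t%:num) *: y.
    by rewrite subKr.
  apply: box_comb => //.
  by have t0 : 0 <= t%:num by []; have t1 : t%:num <= 1 by []; lra.
move=> x bx A [cA pA]; elim/box_ind: bx => [M pM|M y t pM _ AM Ay /andP[t0 t1]].
  exact: pA.
have t01 : 0 <= 1 - t <= 1 by lra.
have := cA M y (Itv01 (proj1 (andP t01)) (proj2 (andP t01))) (mem_set AM) (mem_set Ay).
move=> /set_mem.
by rewrite [conv _ _ _](_ : _ = (1 - t) *: M + (1 - (1 - t)) *: y) // subKr.
Qed.

End Box.

(** * Faces as sets of prescribed edge sums *)

Section Faces.
Context {R : realType} {m n : nat}.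
Implicit Types (x y M : 'M[R]_(m, n)) (e : edge m n) (c : cell m n).
Implicit Types (MM F : set 'M[R]_(m, n)).

Definition fixed MM e (a : R) := forall M, MM M -> edge_sum e M = a.

(** For a nonempty set of PASMs, the part of [agree MM] in the box is the smallest face containing
    them. For empty [MM] every value is vacuously fixed, so no point agrees as soon as there is an
    edge. *)
Definition agree MM : set 'M[R]_(m, n) :=
  [set x | forall e a, fixed MM e a -> edge_sum e x = a].

Definition free MM e := ~ exists a, fixed MM e a.

Lemma agree_incl MM x : MM x -> agree MM x.
Proof. by move=> Mx e a; apply. Qed.

Lemma pasm01 M e : pasm M -> exists b : bool, edge_sum e M = b%:R.
Proof.
by move=> /pasmP /(_ e); rewrite !inE => /orP[] /eqP ->; [exists false | exists true].
Qed.

Lemma free01 MM e (b : bool) : MM `<=` [set M | pasm M] -> free MM e ->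
  exists2 M, MM M & edge_sum e M = b%:R.
Proof.
move=> MMp; apply: contra_notP => nb; exists (~~ b)%:R => M MMM.
have [b' eM] := pasm01 e (MMp _ MMM).
rewrite eM; congr (nat_of_bool _)%:R; case: (eqVneq b' b) => [bb|].
  by case: nb; exists M; rewrite ?eM ?bb.
by case: b b' {nb eM} => [] [].
Qed.

(** The point is an average of members of [MM] that show both values at every free edge. Linear
    equations valid on [MM] pass to the average; at a free edge, one summand equal to 1 and one
    equal to 0 keep the mean 1/K away from both ends, K being the number of summands. *)
Lemma relative_interior MM : MM !=set0 -> MM `<=` [set M | pasm M] ->
  exists x (r : R), [/\ 0 < r, box x, agree MM x,
    (forall e, free MM e -> r <= edge_sum e x <= 1 - r) &
    (forall w b, (forall M, MM M -> mxdot w M = b) -> mxdot w x = b)].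
Proof.
move=> [M0 MM0] MMp.
(* The index [None] makes the family nonempty in every case; at edges that are not free an arbitrary
   member is taken. *)
have /choice[f fP] : forall p : option (edge m n * bool), exists M, MM M /\
    if p is Some (e, b) then free MM e -> edge_sum e M = b%:R else True.
  case=> [[e b]|]; last by exists M0.
  have [ef|ef] := pselect (free MM e); last by exists M0.
  by have [M] := free01 b MMp ef; exists M.
set T := option (edge m n * bool) in f fP; pose K : R := #|{: T}|%:R.
have K0 : 0 < K by rewrite ltr0n; apply/card_gt0P; exists None.
have avg a : K^-1 * \sum_(p : T) a = a.
  by rewrite sumr_const -[X in K^-1 * X]mulr_natl mulKf ?gt_eqF.
pose x := K^-1 *: \sum_p f p.
have xE e : edge_sum e x = K^-1 * \sum_p edge_sum e (f p).
  by rewrite /x linearZ_LR /= raddf_sum.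
have xfix e a : fixed MM e a -> edge_sum e x = a.
  by move=> ea; rewrite xE (eq_bigr (fun=> a)) ?avg // => p _; apply: ea (fP p).1.
have f01 e p : 0 <= edge_sum e (f p) <= 1 by exact: pasm_box (MMp _ (fP p).1) e.
have bx : box x.
  move=> e; rewrite xE; apply/andP; split.
    by rewrite mulr_ge0 ?invr_ge0 ?(ltW K0) // sumr_ge0 // => p _; case/andP: (f01 e p).
  rewrite -[leRHS](avg 1) ler_wpM2l ?invr_ge0 ?(ltW K0) //.
  by apply: ler_sum => p _; case/andP: (f01 e p).
exists x, K^-1; split=> //; first by rewrite invr_gt0.
  move=> e ef; rewrite xE; apply/andP; split.
    rewrite -[leLHS]mulr1 ler_pM2l ?invr_gt0 // (bigD1 (Some (e, true))) //=.
    rewrite (fP (Some (e, true))).2 //.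
    by rewrite lerDl sumr_ge0 // => p _; case/andP: (f01 e p).
  rewrite -[X in X - _](avg 1) -{3}[K^-1]mulr1 -mulrBr ler_pM2l ?invr_gt0 //.
  rewrite (bigD1 (Some (e, false))) //= (fP (Some (e, false))).2 // add0r.
  rewrite [X in _ <= X - _](bigD1 (Some (e, false))) //= addrAC subrr add0r.
  by apply: ler_sum => p _; case/andP: (f01 e p).
move=> w b wb; rewrite /x linearZ_LR /= raddf_sum /= (eq_bigr (fun=> b)) ?avg //.
by move=> p _; apply: wb (fP p).1.
Qed.

(** Fixed edge sums do not move, and free ones move by at most r, the margin they have at x. *)
Lemma relative_interior_perturb MM x r y : 0 < r -> box x -> agree MM x ->
  (forall e, free MM e -> r <= edge_sum e x <= 1 - r) ->
  (forall e a, fixed MM e a -> edge_sum e y = 0) ->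
  (forall e, -1 <= edge_sum e y <= 1) ->
  (box `&` agree MM) (x + r *: y).
Proof.
move=> r0 bx ax rx y0 y1; split=> [e|e a ea]; rewrite raddfD /= linearZ_LR /=.
  have [[a ea]|ef] := pselect (exists a, fixed MM e a).
    by rewrite (y0 _ _ ea) mulr0 addr0.
  by have := rx _ ef; have := y1 e; nra.
by rewrite (y0 _ _ ea) mulr0 addr0; exact: ax.
Qed.

(** Brings a combination of edge sums into the form required by [face]; the coefficients are its
    values on the matrix units. *)
Lemma mxdot_edge_sums (s : edge m n -> R) :
  exists w, forall x, mxdot w x = \sum_e s e * edge_sum e x.
Proof.
exists (\matrix_(i, j) \sum_e s e * edge_sum e (delta_mx i j)) => x.
transitivity (\sum_i \sum_j \sum_e s e * (x i j * edge_sum e (delta_mx i j))).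
  apply: eq_bigr => i _; apply: eq_bigr => j _; rewrite mxE mulr_suml.
  by apply: eq_bigr => e _; rewrite -mulrA [_ * x i j]mulrC.
under eq_bigr do rewrite exchange_big.
rewrite exchange_big; apply: eq_bigr => e _ /=.
rewrite [in RHS](matrix_sum_delta x) raddf_sum mulr_sumr /=.
apply: eq_bigr => i _; rewrite raddf_sum mulr_sumr /=.
by apply: eq_bigr => j _; rewrite linearZ_LR.
Qed.

(** Edge sums are weighted by 1 at edges fixed to 1, by -1 at edges fixed to 0 and by 0 at free
    edges. On the box each term is at most its value on [MM], so the maximum is reached exactly when
    all fixed edges have their value. *)
Lemma agree_supporting MM : MM `<=` [set M | pasm M] -> MM !=set0 ->
  exists w b, (forall x, box x -> mxdot w x <= b) /\
              (forall x, box x -> (mxdot w x = b <-> agree MM x)).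
Proof.
move=> MMp [M0 MM0].
pose s e : R := if `[< fixed MM e 1 >] then 1 else
                if `[< fixed MM e 0 >] then - 1 else 0.
have [w wE] := mxdot_edge_sums s.
pose t e : R := if `[< fixed MM e 1 >] then 1 else 0.
have le_t x e : box x -> 0 <= t e - s e * edge_sum e x.
  move=> /(_ e) /andP[? ?]; rewrite /t /s.
  by case: asboolP => _; [|case: asboolP => _]; lra.
have diff x : \sum_e t e - mxdot w x = \sum_e (t e - s e * edge_sum e x).
  by rewrite wE sumrB.
exists w, (\sum_e t e); split=> x bx.
  by rewrite -subr_ge0 diff sumr_ge0 // => e _; exact: le_t.
split=> [xt|ax]; last first.
  apply/eqP; rewrite eq_sym -subr_eq0 diff big1 // => e _; rewrite /t /s.
  case: asboolP => [/ax ->|_]; first by rewrite mulr1 subrr.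
  by case: asboolP => [/ax ->|_]; rewrite ?mulr0 ?mul0r subrr.
have /psumr_eq0P xe : \sum_e (t e - s e * edge_sum e x) = 0.
  by rewrite -diff xt subrr.
move=> e a ea; have := xe (fun e _ => le_t x e bx) e isT.
have [[] M0e] := pasm01 e (MMp _ MM0); have := ea _ MM0; rewrite M0e => aE;
  rewrite -{a}aE /= in ea *.
  by rewrite /t /s asboolT //; lra.
have ea1 : ~ fixed MM e 1.
  by move=> /(_ _ MM0); rewrite M0e => /eqP; rewrite eq_sym oner_eq0.
by rewrite /t /s asboolF // asboolT //; lra.
Qed.

Lemma face_agree MM : MM `<=` [set M | pasm M] -> MM !=set0 ->
  face box (box `&` agree MM).
Proof.
move=> MMp MM0; have [w [b [wb wE]]] := agree_supporting MMp MM0.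
exists w, b; split=> //; apply/seteqP; split=> x [bx] ax; split=> //;
  by apply/(wE x bx).
Qed.

Lemma face_sub (P F : set 'M[R]_(m, n)) : face P F -> F `<=` P.
Proof. by move=> [w [b [_ ->]]] x []. Qed.

(** A PASM M in F is a vertex of F: every edge is fixed on {M}, so the supporting functional of {M}
    is maximal on the box at M alone. *)
Lemma pasm_vertices_face F : face box F ->
  pasm_vertices F = [set M | pasm M] `&` F.
Proof.
move=> Ff; apply/seteqP; split=> M [pM].
  by move=> [w [b [_ /seteqP[/(_ M erefl)[]]]]].
move=> FM; split=> //; have [] := @agree_supporting [set M] _ _.
- by move=> _ ->.
- by exists M.
move=> w [b [wb wE]]; exists w, b; split=> [x /(face_sub Ff)|]; first exact: wb.
apply/seteqP; split=> [_ -> /=|x [/(face_sub Ff) bx /= /wE]].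
  by split=> //; apply/wE; [exact: face_sub FM | exact: agree_incl].
by move=> /(_ bx) ax; apply: edge_sum_inj => e; apply: ax => _ ->.
Qed.

Lemma face_comb F x y (t : R) : face box F -> 0 < t < 1 -> box x -> box y ->
  F ((1 - t) *: x + t *: y) -> F x /\ F y.
Proof.
move=> [w [b [wb ->]]] t01 bx by_ [_ /=]; rewrite linearP /= linearZ_LR /=.
by move=> E; have := wb _ bx; have := wb _ by_; split; split => //=; nra.
Qed.

(** In the decomposition of a point of F given by [box_ind], both ends stay in F by [face_comb], and
    fixed edge sums are inherited by combinations. *)
Lemma face_sub_agree F : face box F -> F `<=` agree ([set M | pasm M] `&` F).
Proof.
move=> Ff x Fx; have bx := face_sub Ff Fx; move: x bx Fx.
apply: box_ind => [M pM FM|]; first exact: agree_incl.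
move=> M y t pM by_ aM ay t01 /(face_comb Ff t01 (pasm_box pM) by_)[/aM {}aM /ay {}ay].
by move=> e a ea; rewrite edge_sum_comb (aM _ _ ea) (ay _ _ ea); ring.
Qed.

(** The segment from x to a relative interior point x0 can be prolonged beyond x0 within the box.
    The functional of F is b at x0 and at most b beyond it, hence at least b at x. *)
Lemma agree_sub_face F x : face box F -> [set M | pasm M] `&` F !=set0 ->
  box x -> agree ([set M | pasm M] `&` F) x -> F x.
Proof.
move=> Ff MM0 bx ax.
have [x0 [r [r0 bx0 ax0 rx0 wx0]]] :=
  relative_interior MM0 (@subIsetl _ _ F).
have [] := @relative_interior_perturb _ x0 r (x0 - x) r0 bx0 ax0 rx0.
- by move=> e a ea; rewrite raddfB /= (ax _ _ ea) (ax0 _ _ ea) subrr.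
- by move=> e; rewrite raddfB /=; have := bx e; have := bx0 e; lra.
move=> + _; case: Ff wx0 => [w [b [wb FE]]] wx0 /wb; rewrite FE.
have wx0b : mxdot w x0 = b by apply: wx0 => M [_]; rewrite FE => -[].
rewrite raddfD /= linearZ_LR raddfB /= wx0b => wxb; split=> //=.
by have := wb _ bx; nra.
Qed.

Lemma labeling_ofE MM e a :
  labeling_of MM e a <-> exists2 M, MM M & edge_sum e M = a.
Proof.
by case: e => [[i j]|[i j]]; split=> -[M MMM];
  [move->|move<-|move->|move<-]; exists M.
Qed.

(** Smaller labels leave fewer values, so an edge fixed on [MM'] is fixed to the same value on
    [MM]. *)
Lemma agree_labeling_sub MM MM' :
  labeling_sub (labeling_of MM) (labeling_of MM') -> agree MM `<=` agree MM'.
Proof.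
move=> MMM' x ax e a ea; apply: ax => M MMM.
by have /MMM'/labeling_ofE[M' /ea ->] : labeling_of MM e (edge_sum e M)
  by apply/labeling_ofE; exists M.
Qed.

(** Passing to all PASMs of the face spanned by [MM] changes no label: fixed edges stay fixed, and
    free ones already carry both 0 and 1. *)
Lemma labeling_of_agree MM : MM !=set0 -> MM `<=` [set M | pasm M] ->
  labeling_of ([set M | pasm M] `&` (box `&` agree MM)) = labeling_of MM.
Proof.
move=> [M0 MM0] MMp; apply/funext => e; apply/seteqP; split=> a /labeling_ofE[M].
  move=> [pM [_ aM]] <-; apply/labeling_ofE.
  have [[b eb]|ef] := pselect (exists b, fixed MM e b).
    by exists M0; rewrite ?(aM _ _ eb) ?(eb _ MM0).
  by have [b ->] := pasm01 e pM; exact: free01.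
move=> MMM <-; apply/labeling_ofE; exists M => //.
by split; [exact: MMp | split; [exact/pasm_box/MMp | exact: agree_incl]].
Qed.

End Faces.

(** * Dimension *)

Section DualGraph.
Context {m n : nat}.
Implicit Types (D : pred (edge m n)) (e : edge m n) (c : cell m n).

(** The dual graph restricted to the edges outside [D], those that may be crossed. *)
Definition undrawn_adj D : rel (cell m n) := fun c c' =>
  [exists e, ~~ D e && (((c == lo e) && (c' == hi e)) || ((c == hi e) && (c' == lo e)))].

Lemma undrawn_adj_sym D : connect_sym (undrawn_adj D).
Proof.
apply: sym_connect_sym => c c'; apply/existsP/existsP => -[e /andP[De ce]];
  by exists e; rewrite De; case/orP: ce => /andP[-> ->]; rewrite ?orbT.
Qed.

Lemma undrawn_connect D e : ~~ D e -> connect (undrawn_adj D) (lo e) (hi e).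
Proof. by move=> De; apply: connect1; apply/existsP; exists e; rewrite De !eqxx. Qed.

(** One canonical representative for each class of cells not joined to the exterior. *)
Definition bounded_classes D : {set cell m n} :=
  [set c | roots (undrawn_adj D) c & ~~ connect (undrawn_adj D) None c]%SET.

Lemma bounded_class_root D c : ~~ connect (undrawn_adj D) None c ->
  fingraph.root (undrawn_adj D) c \in bounded_classes D.
Proof.
move=> Nc; rewrite inE roots_root //=; last exact: undrawn_adj_sym.
apply: contra Nc => /connect_trans; apply.
by rewrite undrawn_adj_sym connect_root.
Qed.

(** The exterior is never a representative. The bound keeps a family with one more point than there
    are classes within the range of the maximum in [affine_dim]. *)
Lemma card_bounded_classes D : (#|bounded_classes D| <= m * n)%N.
Proof.
suff : (#|bounded_classes D| < #|{: cell m n}|)%N.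
  by rewrite card_option card_prod !card_ord.
apply: proper_card; apply/fintype.properP; split; first by apply/fintype.subsetP.
by exists None; rewrite // inE connect0 andbF.
Qed.

End DualGraph.

(** * The dimension of a face as a number of classes of cells *)

Section Dimension.
Context {R : realType} {m n : nat} (MM : set 'M[R]_(m, n)).
Hypotheses (MM0 : MM !=set0) (MMp : MM `<=` [set M | pasm M]).

Let D : pred (edge m n) := fun e => `[< free MM e >].
Let W := bounded_classes D.
Let con := connect (undrawn_adj D).

Let notD e : ~~ D e -> exists a, fixed MM e a.
Proof. by move=> /asboolPn /contrapT. Qed.

(** If v annihilates A, its coefficients sum to 0 and the combination z has height 0 at every
    representative. The edge sums of z vanish at edges that are not free, so its heights are
    constant on classes; hence z = 0 and, by affine independence, v = 0. The rows of A are thus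
    independent, and at most as many as its columns. *)
Lemma affine_indep_le k (x : 'I_k -> 'M[R]_(m, n)) : affinely_independent x ->
  (forall i, agree MM (x i)) -> (k <= #|W|.+1)%N.
Proof.
move=> xind Fx.
pose A := \matrix_(i < k) row_mx (1%:M : 'M_1)
  (\row_(w < #|W|) height (enum_val w) (x i)).
suff /eqP <- : row_free A by rewrite -[#|W|.+1]/(1 + #|W|)%N rank_leq_col.
apply: inj_row_free => v vA.
have vA' j : \sum_i v 0 i * A i j = 0 by have /rowP/(_ j) := vA; rewrite !mxE.
apply/rowP => i; rewrite mxE.
apply: (xind (v 0)).
  rewrite -[RHS](vA' (lshift _ 0)); apply: eq_bigr => j _.
  by rewrite mxE row_mxEl mxE eqxx mulr1.
set z := \sum_i _.
have zW w : w \in W -> height w z = 0.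
  move=> wW; rewrite raddf_sum -[RHS](vA' (rshift _ (enum_rank_in wW w))).
  apply: eq_bigr => j _; rewrite /= linearZ_LR mxE row_mxEr mxE.
  by rewrite enum_rankK_in.
have ze e : ~~ D e -> height (hi e) z = height (lo e) z.
  move=> /notD[a ea]; apply/eqP; rewrite -subr_eq0 -edge_sum_height raddf_sum /=.
  rewrite (eq_bigr (fun i => v 0 i * a)).
    rewrite -mulr_suml -[X in X * _](_ : 0 = _) ?mul0r //.
    rewrite -[LHS](vA' (lshift _ 0)); apply: eq_bigr => j _.
    by rewrite mxE row_mxEl mxE eqxx mulr1.
  by move=> j _; rewrite linearZ_LR /= (Fx j _ _ ea).
have zcon c c' : con c c' -> height c z = height c' z.
  move=> /connectP[p + ->]; elim: p c => //= c1 p IH c.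
  move=> /andP[/existsP[e] /andP[/ze E] + /IH <-].
  by case/orP=> /andP[/eqP -> /eqP ->]; rewrite E.
apply: height_inj => c /=; rewrite [RHS]raddf0.
have [/zcon <- //|Nc] := boolP (con None c).
rewrite (zcon _ _ (connect_root _ c)) zW //.
exact: bounded_class_root.
Qed.

(** A relative interior point is moved, for each bounded class, by a small multiple of the matrix
    whose height function is the indicator of that class. *)
Lemma affine_indep_exists : exists x : 'I_#|W|.+1 -> 'M[R]_(m, n),
  affinely_independent x /\ forall i, (box `&` agree MM) (x i).
Proof.
have [x0 [r [r0 bx0 ax0 rx0 _]]] := relative_interior MM0 MMp.
pose chi w := of_height (fun c => (con w c)%:R : R).
have chiE w c : w \in W -> height c (chi w) = (con w c)%:R.
  rewrite inE => /andP[_ Nw]; rewrite of_heightK //.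
  by rewrite /con undrawn_adj_sym (negbTE Nw).
pose x (i : 'I_#|W|.+1) :=
  if unlift ord0 i is Some j then x0 + r *: chi (enum_val j) else x0.
exists x; split; last first.
  move=> i; rewrite /x; case: unlift => [j|//].
  have wW := enum_valP j.
  apply: relative_interior_perturb => // [e a ea|e];
    rewrite edge_sum_height !chiE //.
    (* The two cells beside a fixed edge lie in one class, so the indicator has edge sum 0 there. *)
    have De : ~~ D e by apply/asboolPn => -[]; exists a.
    rewrite (_ : con _ (hi e) = con (enum_val j) (lo e)) ?subrr //.
    apply/idP/idP => /connect_trans; apply; last exact: undrawn_connect.
    by rewrite undrawn_adj_sym; exact: undrawn_connect.
  by case: con; case: con; rewrite /=; lra.
move=> a a0 ax.
have aS : \sum_(j < #|W|) a (lift ord0 j) *: (r *: chi (enum_val j)) = 0.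
  rewrite -[RHS]ax big_ord_recl {1}/x unlift_none.
  under [X in _ = _ + X]eq_bigr do rewrite /x liftK scalerDr.
  by rewrite big_split /= -scaler_suml addrA -scalerDl -big_ord_recl a0 scale0r add0r.
have aj j : a (lift ord0 j) = 0.
  (* The height at the j-th representative isolates the j-th coefficient. *)
  have := congr1 (height (enum_val j)) aS; rewrite raddf0 raddf_sum /=.
  rewrite (bigD1 j) //= big1 => [|k kj]; rewrite !linearZ_LR /= chiE ?enum_valP //.
    rewrite /con connect0 addr0 mulr1 => /eqP; rewrite mulf_eq0 (gt_eqF r0) orbF.
    by move/eqP.
  rewrite (_ : con _ _ = false) ?mulr0 //; apply: contraNF kj.
  have := enum_valP j; have := enum_valP k; rewrite !inE.
  move=> /andP[/eqP rk _] /andP[/eqP rj _] /(fingraph.rootP (undrawn_adj_sym D)).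
  by rewrite rk rj => /enum_val_inj ->; exact: eqxx.
move=> i; case: (unliftP ord0 i) => [j ->|->]; first exact: aj.
by move: a0; rewrite big_ord_recl big1 ?addr0.
Qed.

Lemma affine_dim_agree : affine_dim (box `&` agree MM) = #|W|.
Proof.
rewrite /affine_dim; set k := \max_(_ < _ | _) _.
suff -> : k = #|W|.+1 by rewrite -addn1 PoszD addrK.
apply/eqP; rewrite eqn_leq; apply/andP; split.
  apply/bigmax_leqP => i /asboolP[x [xind Fx]].
  by apply: affine_indep_le xind _ => j; case: (Fx j).
have Wk : (#|W|.+1 < (m * n).+2)%N by rewrite !ltnS card_bounded_classes.
apply: (@leq_bigmax_cond _ _ _ (Ordinal Wk)).
by apply/asboolP; exact: affine_indep_exists.
Qed.

End Dimension.

(** * Drawing in the plane *)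

Section StripArithmetic.
Context {R : realType}.
Implicit Types (u v : R) (i j k l : nat).

(* With u, v the coordinates centred at the outer point and directed into the
   grid, which is the rectangle [1, m + 1] x [1, n + 1], the i-th row of edges
   together with its prolongation to the outer point lies on the broken line
   u = tau m i * cap v, and the j-th column on v = tau n j * cap u.  As there
   are no edges between the boundary vertices, the last threshold is 0. *)
Definition cap (t : R) : R := Num.min 1 t.

Lemma capP t : (t <= 1 /\ cap t = t) \/ (1 <= t /\ cap t = 1).
Proof. by rewrite /cap; case: (lerP 1 t) => ?; [right|left; split=> //; exact: ltW]. Qed.

Definition tau k i : R := if (i < k)%N then (k.+1 - i)%:R else 0.

Lemma tau_ge0 k i : 0 <= tau k i.
Proof. by rewrite /tau; case: ifP. Qed.

Lemma tau_ge2 k i : (i < k)%N -> 2 <= tau k i.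
Proof. by move=> ik; rewrite /tau ik ler_nat; lia. Qed.

Lemma tau_last k i : i.+1 = k -> tau k i = 2 /\ tau k i.+1 = 0.
Proof. by move=> <-; rewrite /tau ltnn ltnSn (_ : _ - i = 2)%N //; lia. Qed.

Lemma tau_step k i : (i.+1 < k)%N -> tau k i = tau k i.+1 + 1.
Proof. by move=> ik; rewrite /tau ik ltnW // natr1; congr _%:R; lia. Qed.

Lemma tau_lt k i j : (i < j)%N -> (j <= k)%N -> tau k j < tau k i.
Proof.
move=> ij jk; rewrite /tau (leq_trans ij jk); case: ltnP => jk'.
  by rewrite ltr_nat; lia.
by rewrite ltr0n; lia.
Qed.

Lemma tau_le k i j : (i <= j)%N -> tau k j <= tau k i.
Proof.
move=> ij; have [jk|kj] := leqP j k; last by rewrite /tau ltnNge ltnW ?tau_ge0.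
by move: ij; rewrite leq_eqVlt => /orP[/eqP ->//|ij]; exact/ltW/tau_lt.
Qed.

(** The closed strip between the broken lines i and i + 1; exchanging u and v gives the strips
    between columns. *)
Definition strip k i u v := tau k i.+1 * cap v <= u <= tau k i * cap v.

Definition open_strip k i u v := tau k i.+1 * cap v < u < tau k i * cap v.

(* The last condition excludes the outer point, which satisfies the others, from
   the arcs that do not end there. *)
Definition arc_set k l i j u v :=
  [/\ u = tau k i * cap v, strip l j v u & (j.+1 < l)%N -> 0 < u].

Lemma strip_cap k i u v : (i < k)%N -> strip k i u v -> 0 <= v.
Proof.
move=> ik /andP[h1 h2]; have := tau_lt (ltnSn i) ik.
by have [[? E]|[? E]] := capP v; move: h1 h2; rewrite E; nra.
Qed.

(** Away from the outer point a cell lies in the open quadrant, where [cap] is positive and can be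
    cancelled. *)
Lemma strip_pos k l i j u v : (i < k)%N -> (j < l)%N ->
  strip k i u v -> strip l j v u -> (u = 0 /\ v = 0) \/ (0 < u /\ 0 < v).
Proof.
move=> ik jl su sv; have v0 := strip_cap ik su; have u0 := strip_cap jl sv.
case/andP: su => _ su; case/andP: sv => _ sv.
have := capP u; have := capP v.
have [v00|vn0] := eqVneq v 0; have [u00|un0] := eqVneq u 0; [by left| | |].
- have up : 0 < u by rewrite lt0r un0.
  by rewrite v00 => -[[_ E]|[]]; [move: su; rewrite v00 E|]; lra.
- have vp : 0 < v by rewrite lt0r vn0.
  by rewrite u00 => _ [[_ E]|[]]; [move: sv; rewrite u00 E|]; lra.
- by right; rewrite !lt0r un0 vn0.
Qed.

Lemma cap_gt0 v : 0 < v -> 0 < cap v.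
Proof. by have [[_ ->]|[_ ->]] := capP v. Qed.

Lemma two_strips_ge1 u v : 2 * cap v <= u -> 2 * cap u <= v -> 0 < u \/ 0 < v ->
  1 <= u /\ 1 <= v.
Proof.
by have [[? ->]|[? ->]] := capP v; have [[? ->]|[? ->]] := capP u;
  move=> h1 h2 [h|h]; split; lra.
Qed.

(** Thresholds other than the last are at least 2, so a cell outside the last row and column lies,
    apart from the outer point, where [cap] is 1 in both coordinates. *)
Lemma inner_strips_ge1 k l i j u v : (i.+1 < k)%N -> (j.+1 < l)%N ->
  strip k i u v -> strip l j v u -> 0 < u \/ 0 < v -> 1 <= u /\ 1 <= v.
Proof.
move=> ik jl su sv; apply: two_strips_ge1.
  case/andP: (su) => h _; apply: le_trans h; have := tau_ge2 ik.
  by have := strip_cap (ltnW ik) su; have [[? ->]|[? ->]] := capP v; nra.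
case/andP: (sv) => h _; apply: le_trans h; have := tau_ge2 jl.
by have := strip_cap (ltnW jl) sv; have [[? ->]|[? ->]] := capP u; nra.
Qed.

(** Thresholds decrease strictly, so for v > 0 distinct strips meet only on the line between two
    neighbours. *)
Lemma strip_succ k i i' u v : (i' < k)%N -> (i < i')%N -> 0 < v ->
  strip k i u v -> strip k i' u v -> i' = i.+1 /\ u = tau k i' * cap v.
Proof.
move=> ik ii' v0 /andP[h1 _] /andP[_ h2]; have c0 := cap_gt0 v0.
have E : i' = i.+1.
  apply/eqP; rewrite eqn_leq ii' andbT leqNgt; apply/negP => lt.
  have := tau_lt lt (ltnW ik); rewrite -(ltr_pM2r c0); lra.
by split=> //; rewrite E in h2 *; lra.
Qed.

Lemma open_strip_arc k l i i' j u v : (i < k)%N ->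
  open_strip k i u v -> ~ arc_set k l i' j u v.
Proof.
move=> ik /andP[h1 h2] [uE _ _].
have c0 : 0 < cap v.
  by have := tau_lt (ltnSn i) ik; nra.
move: h1 h2; rewrite uE !ltr_pM2r //.
by have [/(@tau_le k)|/(@tau_le k)] := leqP i' i; lra.
Qed.

(** Keeps the arcs out of the open exterior cell. *)
Lemma arc_set_le k l i j u v : (j < l)%N -> arc_set k l i j u v ->
  u <= tau k 0 * cap v /\ v <= tau l 0 * cap u.
Proof.
move=> jl [uE sv _]; have u0 := strip_cap jl sv.
have cu : 0 <= cap u by have [[_ ->]|[_ ->]] := capP u.
case/andP: sv => h1 h2.
have v0 : 0 <= v by apply: le_trans h1; rewrite mulr_ge0 ?tau_ge0.
have cv : 0 <= cap v by have [[_ ->]|[_ ->]] := capP v.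
split; first by rewrite uE ler_wpM2r ?tau_le.
by apply: le_trans h2 _; rewrite ler_wpM2r ?tau_le.
Qed.

(** The single formula [arc_set] unfolds into the unit segment of the grid and, for the last edge of
    a line, its prolongation to the outer point. *)
Lemma arc_setP k l i j u v : (i < k)%N -> (j < l)%N ->
  arc_set k l i j u v <->
  (u = tau k i /\ (l - j)%:R <= v <= (l.+1 - j)%:R) \/
  [/\ j.+1 = l, u = tau k i * v & 0 <= v <= 1].
Proof.
move=> ik jl; have T2 := tau_ge2 ik.
have tj : tau l j = (l.+1 - j)%:R by rewrite /tau jl.
have lj : (l.+1 - j)%:R = (l - j)%:R + 1 :> R by rewrite natr1 subSn // ltnW.
move: (jl); rewrite leq_eqVlt => /orP[/eqP jl'|jl'].
  have [t2 t0] := tau_last jl'.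
  have lj1 : (l - j)%:R = 1 :> R by rewrite -jl' subSnn.
  rewrite /arc_set /strip t0 t2 lj lj1; split.
    move=> [uE /andP[h1 h2] _]; have [[v1 E]|[v1 E]] := capP v; rewrite E in uE.
      by right; split=> //; apply/andP; split=> //; lra.
    left; split; first by rewrite uE mulr1.
    by have [[? E']|[? E']] := capP u; rewrite E' in h2; lra.
  case=> [[uE v1]|[_ uE v01]].
    have [[? E]|[? E]] := capP v; have [[? E']|[? E']] := capP u;
      split; rewrite ?E ?E' ?jl' ?ltnn //; try lra.
    by rewrite (_ : v = 1) ?mulr1 //; lra.
  have [[? E]|[? E]] := capP v; have [[? E']|[? E']] := capP u;
      split; rewrite ?E ?E' ?jl' ?ltnn //; try nra.
have tj1 : tau l j.+1 = (l - j)%:R by rewrite /tau jl' subSS.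
have t2 := tau_ge2 jl'.
rewrite /arc_set /strip tj tj1 lj in t2 *; split.
  move=> [uE h /(_ jl') u0]; left.
  have [u1 v1] : 1 <= u /\ 1 <= v.
    apply: two_strips_ge1; last by left.
      by rewrite uE; have [[? E]|[? E]] := capP v; rewrite E in uE *; nra.
    by case/andP: h => h _; apply: le_trans h; have [[? ->]|[? ->]] := capP u; nra.
  have [[? E]|[? E]] := capP v; have [[? E']|[? E']] := capP u; rewrite ?E ?E' in uE h;
    by split; nra.
case=> [[uE v1]|[jl'' _ _]]; last by move: jl'; rewrite jl'' ltnn.
have [[? E]|[? E]] := capP v; have [[? E']|[? E']] := capP u;
  split; rewrite ?E ?E' //; lra.
Qed.

(** The midpoint of the thresholds of strip i, which are 2 and 0 in the last strip. *)
Definition ctr k i : R := if (i.+1 < k)%N then tau k i - 2^-1 else 1.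

Lemma ctr_ge1 k i : 1 <= ctr k i.
Proof.
rewrite /ctr; case: ifP => // ik; have := tau_ge2 (ltnW ik); lra.
Qed.

(* Cells need not be convex, but they are star-shaped: each of their defining
   inequalities involves [cap] concavely or is an equality in [cap] along the
   segment to the centre. *)
Lemma star_strip k l i j u v (t : R) : (i < k)%N -> (j < l)%N -> 0 < t <= 1 ->
  strip k i u v -> strip l j v u ->
  ((i.+1 < k)%N -> (j.+1 < l)%N -> 1 <= u + v) ->
  open_strip k i ((1 - t) * u + t * ctr k i) ((1 - t) * v + t * ctr l j).
Proof.
move=> ik jl t01 su sv uv; set v' := (1 - t) * v + _.
have u0 := strip_cap jl sv; have v0 := strip_cap ik su.
have cj := ctr_ge1 l j; have ci := ctr_ge1 k i.
have concave : (1 - t) * cap v + t <= cap v'.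
  by have [[? ->]|[? ->]] := capP v; have [[? ->]|[? ->]] := capP v'; rewrite /v'; nra.
have T2 := tau_ge2 ik.
have c_lt : ctr k i < tau k i by rewrite /ctr; case: ifP => _; lra.
case/andP: (su) => h1 h2; apply/andP; split; last by nra.
move: (ik); rewrite leq_eqVlt => /orP[/eqP ik'|ik'].
  by rewrite (tau_last ik').2 mul0r; nra.
(* [cap] is affine along the segment: in the last column the centre sits at its kink 1, elsewhere v
   >= 1 throughout. *)
have convex : cap v' <= (1 - t) * cap v + t.
  move: (jl); rewrite leq_eqVlt => /orP[/eqP jl'|jl'].
    have cE : ctr l j = 1 by rewrite /ctr jl' ltnn.
    by have [[? ->]|[? ->]] := capP v; have [[? ->]|[? ->]] := capP v';
      move: (erefl v') => /=; rewrite {1}/v' cE; nra.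
  have [_ v1] : 1 <= u /\ 1 <= v.
    apply: inner_strips_ge1 su sv _ => //.
    by have [?|?] := ltP 0 u; [left|right; have := uv ik' jl'; lra].
  by have [[? ->]|[? ->]] := capP v; have [[? ->]|[? ->]] := capP v'; nra.
have : ctr k i = tau k i.+1 + 2^-1 by rewrite /ctr ik' tau_step //; lra.
have := tau_ge0 k i.+1.
nra.
Qed.

Lemma strip_exists k u v : (0 < k)%N -> 0 <= u < tau k 0 * cap v ->
  exists2 i, (i < k)%N & strip k i u v.
Proof.
move=> k0 /andP[u0 ulet].
have ex : exists i, tau k i.+1 * cap v <= u.
  by exists k.-1; rewrite (tau_last (prednK k0)).2 mul0r.
case: (ex_minnP ex) => i iP imin; exists i.
  have : (i <= k.-1)%N.
    by apply: imin; rewrite (tau_last (prednK k0)).2 mul0r.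
  by lia.
rewrite /strip iP /=; case: i imin {iP} => [|i] imin; first exact: ltW.
by apply/ltW; rewrite ltNge; apply/negP => /imin; rewrite ltnn.
Qed.

(** If u <= 0 then v < u, and if v <= 0 then u < v. So both coordinates are positive outside the
    exterior cell. *)
Lemma below_pos (s t u v : R) : 1 <= s -> 1 <= t ->
  u < s * cap v -> v < t * cap u -> 0 < u /\ 0 < v.
Proof.
move=> s1 t1; have [[? ->]|[? ->]] := capP v; have [[? ->]|[? ->]] := capP u => h1 h2.
- have [u0|u0] := ltP 0 u; first by nra.
  by have [v0|v0] := ltP 0 v; nra.
all: split; nra.
Qed.

End StripArithmetic.

(** * Midpoints of edges *)

Section EdgeMidpoints.
Context {R : realType}.
Implicit Types (i j k l : nat).

Lemma ctr_itv k i : (i < k)%N -> tau k i.+1 < (ctr k i : R) < tau k i.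
Proof.
move=> ik; rewrite /ctr; case: ifP => i1.
  by rewrite (@tau_step R _ _ i1); apply/andP; split; lra.
have [-> ->] : tau k i = 2 :> R /\ tau k i.+1 = 0 :> R.
  by apply: tau_last; apply/eqP; rewrite eqn_leq ik /= leqNgt i1.
by apply/andP; split; lra.
Qed.

Lemma tau_half k i : (i < k)%N -> tau k i.+1 < tau k i - 2^-1 :> R.
Proof.
move=> ik; move: (ik); rewrite leq_eqVlt => /orP[/eqP/(@tau_last R _ _)[-> ->]|i1].
  by lra.
by rewrite (@tau_step R _ _ i1); lra.
Qed.

Lemma tau_half_neq k i j : (i < k)%N -> tau k i - 2^-1 <> tau k j :> R.
Proof.
move=> ik; have h := tau_half ik.
by have [/(@tau_le R k _ _)|/(@tau_le R k _ _)] := leqP j i; lra.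
Qed.

Lemma cap1 (t : R) : 1 <= t -> cap t = 1.
Proof. by have [[? ->]|[? ->]] := capP t; lra. Qed.

Lemma tau_inj k i j : (i < k)%N -> (j < k)%N -> tau k i = tau k j :> R -> i = j.
Proof.
move=> ik jk E; have [ij|ji|//] := ltngtP i j.
  by have := @tau_lt R _ _ _ ij (ltnW jk); rewrite E ltxx.
by have := @tau_lt R _ _ _ ji (ltnW ik); rewrite E ltxx.
Qed.

(* In the coordinates centred at the outer point, (tau k i, tau l j - 1/2) is the
   midpoint of the edge (i, j). *)
Lemma midpoint_arc k l i j i' j' :
  (i < k)%N -> (j < l)%N -> (i' < k)%N -> (j' < l)%N ->
  arc_set k l i' j' (tau k i : R) (tau l j - 2^-1) -> i' = i /\ j' = j.
Proof.
move=> ik jl ik' jl' [+ + _]; rewrite /strip.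
have h := tau_half jl; have t2 := @tau_ge2 R _ _ jl; have s2 := @tau_ge2 R _ _ ik.
rewrite !cap1 ?mulr1; [|lra..] => /tau_inj -> // /andP[h1 h2]; split=> //.
have [jj|jj|//] := ltngtP j' j.
  by exfalso; have := @tau_le R l _ _ jj; lra.
by exfalso; have := @tau_le R l _ _ jj; lra.
Qed.

(** The half-integral coordinate of a midpoint differs from all thresholds, which are integers. *)
Lemma midpoint_cross_arc k l i j i' j' : (i < k)%N -> (j < l)%N ->
  ~ arc_set l k j' i' (tau l j - 2^-1 : R) (tau k i).
Proof.
move=> ik jl [+ _ _]; rewrite cap1 ?mulr1; first exact: tau_half_neq.
by have := @tau_ge2 R _ _ ik; lra.
Qed.

End EdgeMidpoints.

(** * Connectedness in the plane *)

Section Plane.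
Context {R : realType}.
Local Notation plane := (R^o * R^o)%type.

Lemma segment_is_connected (p q : plane) : connected (segment p q).
Proof.
apply: connected_continuous_connected; first exact: segment_connected.
apply: continuous_subspaceT => t.
by apply: cvgD; [exact: cvg_cst | apply: cvgZr_tmp; exact: cvg_id].
Qed.

Lemma segmentP (p q x : plane) : segment p q x <-> exists2 t : R, 0 <= t <= 1 &
  x.1 = p.1 + t * (q.1 - p.1) /\ x.2 = p.2 + t * (q.2 - p.2).
Proof.
split=> [[t /= + <-]|[t t01 [x1 x2]]]; first by rewrite in_itv; exists t.
by exists t; rewrite /= ?in_itv //; case: x x1 x2 => ? ? /= -> ->.
Qed.

Lemma segment_component (A : set plane) p q : segment p q `<=` A ->
  connected_component A p = connected_component A q.
Proof.
move=> sA; have [sp sq] : segment p q p /\ segment p q q.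
  split; [exists 0; last by rewrite scale0r addr0
         |exists 1; last by rewrite scale1r addrC subrK];
  by rewrite /= in_itv /= lexx ler01.
apply: same_connected_component.
by apply: (connected_component_max sp sA (@segment_is_connected p q) sq).
Qed.

Lemma closed_le_continuous (T : topologicalType) (f g : T -> R^o) :
  continuous f -> continuous g -> closed [set p | f p <= g p].
Proof.
move=> cf cg; pose h p : R^o := f p - g p.
have hc : continuous h by move=> p; apply: cvgB; [exact: cf|exact: cg].
rewrite (_ : mkset _ = h @^-1` [set r : R | r <= 0]).
  apply: preimage_closed; last exact: closed_le.
  by move=> p _; exact: hc.
by apply/seteqP; split=> p /=; rewrite /h subr_le0.
Qed.

Lemma connected_closed_cover (T : topologicalType) (X A B : set T) :
  connected X -> closed A -> closed B -> X `<=` A `|` B ->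
  X `&` A `&` B = set0 -> X `&` A !=set0 -> X `<=` A.
Proof.
move=> cX cA cB XAB XAB0 XA0.
suff <- : X `&` A = X by move=> x [].
apply: cX => //; last by exists A.
exists (~` B); first exact: closed_openC.
apply/seteqP; split=> x [Xx].
  by move=> Ax; split=> // Bx; suff : set0 x by []; rewrite -XAB0.
by move=> nBx; split=> //; case: (XAB _ Xx).
Qed.

End Plane.

(** * Arcs in coordinates centred at the outer point *)

Section Coordinates.
Context {R : realType} {m n : nat}.
Local Notation plane := (R^o * R^o)%type.
Implicit Types (p q : plane) (e : edge m n) (c : cell m n).

Definition ucoord p : R := m.+1%:R - p.1.
Definition vcoord p : R := n.+1%:R - p.2.

Lemma tau_nat k i : (i < k)%N -> tau k i = k.+1%:R - i%:R :> R.
Proof. by move=> ik; rewrite /tau ik natrB // ltnW // ltnW. Qed.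

Lemma edge_arcP e p : @edge_arc R m n e p <->
  match e with
  | inl (i, j) => arc_set m n i j (ucoord p) (vcoord p)
  | inr (i, j) => arc_set n m j i (vcoord p) (ucoord p)
  end.
Proof.
case: e => [[i j]|[i j]].
  apply: iff_trans (iff_sym (arc_setP _ _ _ _)) => //.
  rewrite (tau_nat (ltn_ord i)) (@natrB _ n.+1) ?(@natrB _ n) ?leqW
    ?(ltnW (ltn_ord j)) //.
  rewrite /edge_arc /internal /ucoord /vcoord /= /bump /= add1n ltn_ord /= -!natr1.
  split=> [[/segmentP[t t01]|]|].
  - rewrite /= /bump add1n -natr1 => -[-> ->]; left.
    by split; [ring | apply/andP; split; lra].
  - case: ltnP => // nj /segmentP[t t01].
    have jn : j.+1 = n by apply/eqP; rewrite eqn_leq nj ltn_ord.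
    rewrite /= /bump add1n jn -!natr1 => -[-> ->]; right.
    by split=> //; [ring | apply/andP; split; lra].
  - case=> [[p1 p2]|[jn p1 p2]].
      left; apply/segmentP; exists (p.2 - j%:R); first by apply/andP; split; lra.
      by rewrite /= /bump add1n -natr1; split; [lra | ring].
    (* Along the prolongation the second coordinate runs from n to n + 1, so p.2 - n is the
       parameter. *)
    right; rewrite jn ltnn; apply/segmentP; exists (p.2 - n%:R).
      by apply/andP; split; lra.
    rewrite /= /bump add1n jn -!natr1; split; last ring.
    apply/eqP; rewrite eq_sym -subr_eq0; apply/eqP.
    by move: p1 => /eqP; rewrite -subr_eq0 => /eqP <-; ring.
apply: iff_trans (iff_sym (arc_setP _ _ _ _)) => //.
rewrite (tau_nat (ltn_ord j)) (@natrB _ m.+1) ?(@natrB _ m) ?leqW ?(ltnW (ltn_ord i)) //.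
rewrite /edge_arc /internal /ucoord /vcoord /= /bump /= add1n ltn_ord andbT /= -!natr1.
split=> [[/segmentP[t t01]|]|].
- rewrite /= /bump add1n -natr1 => -[-> ->]; left.
  by split; [ring | apply/andP; split; lra].
- case: ltnP => // mi /segmentP[t t01].
  have im : i.+1 = m by apply/eqP; rewrite eqn_leq mi ltn_ord.
  rewrite /= /bump add1n im -!natr1 => -[-> ->]; right.
  by split=> //; [ring | apply/andP; split; lra].
- case=> [[p1 p2]|[im p1 p2]].
    left; apply/segmentP; exists (p.1 - i%:R); first by apply/andP; split; lra.
    by rewrite /= /bump add1n -natr1; split; [ring | lra].
  right; rewrite im ltnn; apply/segmentP; exists (p.1 - m%:R).
    by apply/andP; split; lra.
  rewrite /= /bump add1n im -!natr1; split; first ring.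
  apply/eqP; rewrite eq_sym -subr_eq0; apply/eqP.
  by move: p1 => /eqP; rewrite -subr_eq0 => /eqP <-; ring.
Qed.
End Coordinates.

(** * Closed and open cells *)

Section Cells.
Context {R : realType} {m n : nat}.
Hypotheses (m_gt0 : (0 < m)%N) (n_gt0 : (0 < n)%N).
Local Notation plane := (R^o * R^o)%type.
Implicit Types (p q : plane) (e : edge m n) (c : cell m n).
Local Notation u := (@ucoord R m).
Local Notation v := (@vcoord R n).

(* The last condition excludes the outer point from the cells not touching it. *)
Definition cell_set c : set plane := fun p =>
  match c with
  | Some (i, j) => [/\ strip m i (u p) (v p), strip n j (v p) (u p) &
      (i.+1 < m)%N -> (j.+1 < n)%N -> 1 <= u p + v p]
  | None => tau m 0 * cap (v p) <= u p \/ tau n 0 * cap (u p) <= v p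
  end.

Definition open_cell c : set plane := fun p =>
  match c with
  | Some (i, j) => open_strip m i (u p) (v p) /\ open_strip n j (v p) (u p)
  | None => tau m 0 * cap (v p) < u p \/ tau n 0 * cap (u p) < v p
  end.

Lemma open_cell_arc c e p : open_cell c p -> ~ @edge_arc R m n e p.
Proof.
case: c => [[i j]|] /= op /edge_arcP; case: e => [[i' j']|[i' j']].
- by apply: open_strip_arc op.1.
- by apply: open_strip_arc op.2.
- by move=> /arc_set_le -/(_ (ltn_ord j')); case: op; lra.
- by move=> /arc_set_le -/(_ (ltn_ord i')); case: op; lra.
Qed.

Lemma cell_set_cover p : exists c, cell_set c p.
Proof.
have [h|h] := pselect (cell_set None p); first by exists None.
have [hu hv] : u p < tau m 0 * cap (v p) /\ v p < tau n 0 * cap (u p).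
  by split; rewrite ltNge; apply/negP => ?; apply: h; [left | right].
have [u0 v0] : 0 < u p /\ 0 < v p.
  have := tau_ge2 m_gt0 : 2 <= _ :> R; have := tau_ge2 n_gt0 : 2 <= _ :> R => ? ?.
  by apply: below_pos hu hv; lra.
have [i im si] : exists2 i, (i < m)%N & strip m i (u p) (v p).
  by apply: strip_exists => //; rewrite ltW.
have [j jn sj] : exists2 j, (j < n)%N & strip n j (v p) (u p).
  by apply: strip_exists => //; rewrite ltW.
exists (Some (Ordinal im, Ordinal jn)); split=> //= i1 j1.
by have [] := inner_strips_ge1 i1 j1 si sj (or_introl u0); lra.
Qed.

Lemma ucoord_continuous : continuous (u : plane -> R^o).
Proof. by move=> p; apply: cvgB; [exact: cvg_cst | exact: cvg_fst]. Qed.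

Lemma vcoord_continuous : continuous (v : plane -> R^o).
Proof. by move=> p; apply: cvgB; [exact: cvg_cst | exact: cvg_snd]. Qed.

Lemma scale_cap_continuous (a : R) (f : plane -> R^o) : continuous f ->
  continuous (fun p => a * cap (f p) : R^o).
Proof.
move=> cf p; apply: cvgM; first exact: cvg_cst.
by apply: (@continuous_min R _ (cst (1 : R^o)) f p); [exact: cst_continuous | exact: cf].
Qed.

Lemma closed_cell_set c : closed (cell_set c).
Proof.
have cu := ucoord_continuous; have cv := vcoord_continuous.
have cau a := @scale_cap_continuous a _ cu; have cav a := @scale_cap_continuous a _ cv.
case: c => [[i j]|]; last first.
  by apply: closedU; apply: closed_le_continuous.
rewrite (_ : cell_set _ = ([set p | tau m i.+1 * cap (v p) <= u p] `&`
  [set p | u p <= tau m i * cap (v p)]) `&` ([set p | tau n j.+1 * cap (u p) <= v p] `&`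
  [set p | v p <= tau n j * cap (u p)]) `&`
  [set p | (i.+1 < m)%N -> (j.+1 < n)%N -> 1 <= u p + v p]).
  apply: closedI; first by do 2?apply: closedI; exact: closed_le_continuous.
  have [h|h] := boolP ((i.+1 < m) && (j.+1 < n))%N.
    case/andP: h => i1 j1.
    rewrite (_ : mkset _ = [set p | 1 <= u p + v p]); last first.
      by apply/seteqP; split=> p /=; [apply|].
    apply: closed_le_continuous => p; first exact: cvg_cst.
    by apply: cvgD; [exact: cu | exact: cv].
  rewrite (_ : mkset _ = setT); first exact: closedT.
  apply/seteqP; split=> // p _ /= i1 j1; by rewrite i1 j1 in h.
apply/seteqP; split=> p.
  by case=> /andP[? ?] /andP[? ?] ?; split.
by case=> -[[? ?] [? ?]] ?; split=> //; apply/andP.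
Qed.

(** For the exterior, a point beyond the upper left corner of the grid, common to the half planes
    above the grid and to its left. *)
Definition center c : plane :=
  if c is Some (i, j) then (m.+1%:R - ctr m i, n.+1%:R - ctr n j) else (-1, -1).

Lemma ucoord_segment p q x (t : R) : x.1 = p.1 + t * (q.1 - p.1) ->
  u x = (1 - t) * u p + t * u q.
Proof. by move=> xE; rewrite /ucoord xE; ring. Qed.

Lemma vcoord_segment p q x (t : R) : x.2 = p.2 + t * (q.2 - p.2) ->
  v x = (1 - t) * v p + t * v q.
Proof. by move=> xE; rewrite /vcoord xE; ring. Qed.

Lemma segment_to_center i j p q : cell_set (Some (i, j)) p ->
  segment p (center (Some (i, j))) q -> q <> p -> open_cell (Some (i, j)) q.
Proof.
move=> [si sj h] /segmentP[t t01 [q1 q2]] qp.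
have t0 : 0 < t <= 1.
  case/andP: t01 => t0 ->; rewrite andbT lt_neqAle t0 andbT eq_sym.
  apply/eqP => t0'; apply: qp; case: q q1 q2 => ? ?; case: p {si sj h} => ? ? /=.
  by rewrite t0' => -> ->; rewrite !mul0r !addr0.
have uc : u (center (Some (i, j))) = ctr m i by rewrite /ucoord /= subKr.
have vc : v (center (Some (i, j))) = ctr n j by rewrite /vcoord /= subKr.
split; rewrite (ucoord_segment q1) (vcoord_segment q2) uc vc; apply: star_strip => //.
by move=> j1 i1; rewrite addrC; exact: h.
Qed.

End Cells.

(** * Components of the complement of the drawing *)

Section Regions.
Context {R : realType} {m n : nat}.
Hypotheses (m_gt0 : (0 < m)%N) (n_gt0 : (0 < n)%N).
Local Notation plane := (R^o * R^o)%type.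
Implicit Types (p q : plane) (e : edge m n) (c : cell m n).
Local Notation u := (@ucoord R m).
Local Notation v := (@vcoord R n).
Variable D : pred (edge m n).
Local Notation con := (connect (undrawn_adj D)).

Definition drawn : set plane := \bigcup_(e in [set e | D e]) @edge_arc R m n e.
Local Notation comp := (connected_component (~` drawn)).

Lemma undrawn_arc e p : ~ drawn p -> @edge_arc R m n e p -> ~~ D e.
Proof. by move=> dp ep; apply/negP => De; apply: dp; exists e. Qed.

Lemma open_cell_undrawn c p : open_cell c p -> ~ drawn p.
Proof. by move=> cp [e _]; exact: open_cell_arc cp. Qed.

Lemma open_segment_component c p q : ~ drawn p ->
  (forall x (t : R), 0 < t <= 1 -> u x = (1 - t) * u p + t * u q ->
     v x = (1 - t) * v p + t * v q -> open_cell c x) ->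
  comp p = comp q.
Proof.
move=> dp pq; apply: segment_component => x /segmentP[t t01 [x1 x2]].
have [t0|t0] := eqVneq t 0.
  suff -> : x = p by [].
  by move: x1 x2; rewrite t0 !mul0r !addr0; case: x p {dp pq} => ? ? [? ?] /= -> ->.
apply: (@open_cell_undrawn c); apply: (pq _ t).
- by rewrite lt_neqAle eq_sym t0.
- exact: ucoord_segment.
- exact: vcoord_segment.
Qed.

Lemma open_cell_center c : open_cell c (@center R m n c).
Proof.
case: c => [[i j]|].
  rewrite /= /ucoord /vcoord /= !subKr /open_strip !cap1 ?ctr_ge1 // !mulr1.
  by rewrite !ctr_itv.
left; rewrite /= /ucoord /vcoord /= cap1 ?mulr1 ?tau_nat //; last first.
  by have : 0 <= n.+1%:R :> R; [|lra].
lra.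
Qed.

(** A bounded cell is star-shaped about its centre. In the exterior, p is joined to the centre
    directly when it lies in one of the two half planes, and otherwise through a point of such a
    half plane. *)
Lemma cell_component c p : cell_set c p -> ~ drawn p -> comp p = comp (center c).
Proof.
case: c => [[i j]|] cp dp.
  apply: segment_component => q pq.
  have [->//|qp] := pselect (q = p).
  exact: open_cell_undrawn (segment_to_center cp pq qp).
have uc : u (@center R m n None) = m.+1%:R + 1 by rewrite /ucoord /=; lra.
have vc : v (@center R m n None) = n.+1%:R + 1 by rewrite /vcoord /=; lra.
have tm : tau m 0 = m.+1%:R :> R by rewrite tau_nat // subr0.
have tn : tau n 0 = n.+1%:R :> R by rewrite tau_nat // subr0.
have M0 : 0 < m.+1%:R :> R by rewrite ltr0n.
have N0 : 0 < n.+1%:R :> R by rewrite ltr0n.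
have cap_le1 (t : R) : cap t <= 1 by have [[? ->]|[? ->]] := capP t.
have cap_le (t : R) : cap t <= t by have [[? ->]|[? ->]] := capP t.
have uhalf p' : ~ drawn p' -> m.+1%:R <= u p' -> comp p' = comp (@center R m n None).
  move=> dp' hp; apply: (@open_segment_component None) => // x t t01 ux _.
  by left; rewrite tm ux uc; have := cap_le1 (v x); nra.
have vhalf p' : ~ drawn p' -> n.+1%:R <= v p' -> comp p' = comp (@center R m n None).
  move=> dp' hp; apply: (@open_segment_component None) => // x t t01 _ vx.
  by right; rewrite tn vx vc; have := cap_le1 (u x); nra.
case: cp => h.
  have [[_ vE]|[_ vE]] := capP (v p); rewrite vE tm in h; last by apply: uhalf => //; lra.
  (* Here [cap (v p)] is [v p], so the exterior inequality is linear at p; as v vanishes at q, it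
     stays valid up to q. *)
  pose q : plane := (-1, n.+1%:R).
  have uq : u q = m.+1%:R + 1 by rewrite /ucoord /=; lra.
  have vq : v q = 0 by rewrite /vcoord /= subrr.
  have oq : open_cell (m := m) (n := n) None q.
    by left; rewrite tm uq; have := cap_le1 (v q); nra.
  rewrite -(@uhalf q) ?uq; [|exact: open_cell_undrawn oq|lra].
  apply: (@open_segment_component None) => // x t t01 ux vx.
  by left; rewrite tm ux uq; have := cap_le (v x); rewrite [in X in _ <= X]vx vq; nra.
have [[_ uE]|[_ uE]] := capP (u p); rewrite uE tn in h; last by apply: vhalf => //; lra.
pose q : plane := (m.+1%:R, -1).
have vq : v q = n.+1%:R + 1 by rewrite /vcoord /=; lra.
have uq : u q = 0 by rewrite /ucoord /= subrr.
have oq : open_cell (m := m) (n := n) None q.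
  by right; rewrite tn vq; have := cap_le1 (u q); nra.
rewrite -(@vhalf q) ?vq; [|exact: open_cell_undrawn oq|lra].
apply: (@open_segment_component None) => // x t t01 ux vx.
by right; rewrite tn vx vq; have := cap_le (u x); rewrite [in X in _ <= X]ux uq; nra.
Qed.

Definition midpoint e : plane :=
  match e with
  | inl (i, j) => (m.+1%:R - tau m i, n.+1%:R - (tau n j - 2^-1))
  | inr (i, j) => (m.+1%:R - (tau m i - 2^-1), n.+1%:R - tau n j)
  end.

Lemma midpoint_undrawn e : ~~ D e -> ~ drawn (midpoint e).
Proof.
move=> De [e' /= De' /edge_arcP]; move: De.
rewrite /ucoord /vcoord; case: e => [[i j]|[i j]];
  case: e' De' => [[i' j']|[i' j']] De' De; rewrite /= !subKr.
- move=> /midpoint_arc [] // /val_inj ii /val_inj jj; by rewrite -ii -jj De' in De.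
- exact: midpoint_cross_arc.
- exact: midpoint_cross_arc.
- move=> /midpoint_arc [] // /val_inj ii /val_inj jj; by rewrite -ii -jj De' in De.
Qed.

(** The midpoint is where an undrawn edge is crossed from one cell to the other. *)
Lemma midpoint_cells e : cell_set (hi e) (midpoint e) /\ cell_set (lo e) (midpoint e).
Proof.
have half k (i : 'I_k) : [/\ tau k i.+1 <= tau k i :> R,
    tau k i.+1 <= tau k i - 2^-1 :> R & 2 <= tau k i :> R].
  have h := tau_half (R := R) (ltn_ord i).
  by split; [exact: tau_le | exact: ltW | exact: tau_ge2].
case: e => [[i j]|[i j]] /=; have [i1 i2 i3] := half _ i; have [j1 j2 j3] := half _ j.
  split; first by rewrite /ucoord /vcoord /= !subKr /strip !cap1 ?mulr1;
    [split; [apply/andP|apply/andP|]|..]; lra.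
  case: opredP => [i0|i' ii] /=;
    rewrite /ucoord /vcoord /= !subKr /strip !cap1 ?mulr1; try lra.
    by left; rewrite i0.
  have [i1' i2' i3'] := half _ i'; rewrite ii in i1 i2 i3 *.
  split; [apply/andP|apply/andP|]; lra.
split; first by rewrite /ucoord /vcoord /= !subKr /strip !cap1 ?mulr1;
    [split; [apply/andP|apply/andP|]|..]; lra.
case: opredP => [j0|j' jj] /=;
  rewrite /ucoord /vcoord /= !subKr /strip !cap1 ?mulr1; try lra.
  by right; rewrite j0.
have [j1' j2' j3'] := half _ j'; rewrite jj in j1 j2 j3 *.
split; [apply/andP|apply/andP|]; lra.
Qed.

Lemma connect_component c c' : con c c' -> comp (center c) = comp (center c').
Proof.
have step e : ~~ D e -> comp (center (lo e)) = comp (center (hi e)).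
  move=> De; have [hm lm] := midpoint_cells e; have dm := midpoint_undrawn De.
  by rewrite -(cell_component hm dm) -(cell_component lm dm).
move=> /connectP[s + ->]; elim: s c => //= c1 s IH c.
move=> /andP[/existsP[e /andP[/step E +]] /IH <-].
by case/orP=> /andP[/eqP -> /eqP ->].
Qed.

(** A point in two row strips lies on the arc between the two cells; as the point is undrawn, so is
    that edge. *)
Lemma strip_adj_row (i i' : 'I_m) (j : 'I_n) p : 0 < u p -> 0 < v p -> ~ drawn p ->
  strip m i (u p) (v p) -> strip m i' (u p) (v p) -> strip n j (v p) (u p) ->
  con (Some (i, j)) (Some (i', j)).
Proof.
move=> u0 v0 dp si si' sj.
wlog ii' : i i' si si' / (i < i')%N.
  move=> wl; have [ii|ii|/val_inj ->] := ltngtP i i'; [exact: wl| |exact: connect0].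
  by rewrite undrawn_adj_sym; exact: wl.
have [iE uE] := strip_succ (ltn_ord i') ii' v0 si si'.
have De : ~~ D (inl (i', j)) by apply: (undrawn_arc dp); apply/edge_arcP.
by have := undrawn_connect De; rewrite /= (opred_succ iE).
Qed.

Lemma strip_adj_col (i : 'I_m) (j j' : 'I_n) p : 0 < u p -> 0 < v p -> ~ drawn p ->
  strip m i (u p) (v p) -> strip n j (v p) (u p) -> strip n j' (v p) (u p) ->
  con (Some (i, j)) (Some (i, j')).
Proof.
move=> u0 v0 dp si sj sj'.
wlog jj' : j j' sj sj' / (j < j')%N.
  move=> wl; have [jj|jj|/val_inj ->] := ltngtP j j'; [exact: wl| |exact: connect0].
  by rewrite undrawn_adj_sym; exact: wl.
have [jE vE] := strip_succ (ltn_ord j') jj' u0 sj sj'.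
have De : ~~ D (inr (i, j')) by apply: (undrawn_arc dp); apply/edge_arcP.
by have := undrawn_connect De; rewrite /= (opred_succ jE).
Qed.

(** All arcs leaving the last row downwards or the last column to the right end at the outer point.
    If that point is undrawn, so are these edges, and crossing them one after the other leads from
    the exterior along the row or column. *)
Lemma boundary_cell_exterior (i : 'I_m) (j : 'I_n) p : u p = 0 -> v p = 0 -> ~ drawn p ->
  i.+1 = m \/ j.+1 = n -> con None (Some (i, j)).
Proof.
move=> u0 v0 dp.
have cap0 : cap (0 : R) = 0 by have [[? ->]|[]] := capP (0 : R); lra.
have strip0 k l : strip k l (0 : R) 0 by rewrite /strip cap0 !mulr0 lexx.
case=> [im|jn].
  have De j' : ~~ D (inr (i, j')).
    apply: (undrawn_arc dp); apply/edge_arcP; rewrite u0 v0; split=> //.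
      by rewrite cap0 mulr0.
    by rewrite im ltnn.
  case: j => j jn; elim: j jn => [|j IH] jn.
    exact: (undrawn_connect (De (Ordinal jn))).
  apply: connect_trans (IH (ltnW jn)) _.
  have := undrawn_connect (De (Ordinal jn)).
  by rewrite /= (@opred_succ _ (Ordinal (ltnW jn))).
have De i' : ~~ D (inl (i', j)).
  apply: (undrawn_arc dp); apply/edge_arcP; rewrite u0 v0; split=> //.
    by rewrite cap0 mulr0.
  by rewrite jn ltnn.
case: i => i im; elim: i im => [|i IH] im.
  exact: (undrawn_connect (De (Ordinal im))).
apply: connect_trans (IH (ltnW im)) _.
have := undrawn_connect (De (Ordinal im)).
by rewrite /= (@opred_succ _ (Ordinal (ltnW im))).
Qed.

Lemma cell_exterior_adj (i : 'I_m) (j : 'I_n) p : ~ drawn p ->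
  cell_set (Some (i, j)) p -> @cell_set R m n None p -> con None (Some (i, j)).
Proof.
move=> dp [si sj h].
have [[u0 v0] _|[u0 v0]] := strip_pos (ltn_ord i) (ltn_ord j) si sj.
  apply: (boundary_cell_exterior u0 v0 dp).
  (* By the last condition of [cell_set], only cells of the last row or column contain the outer
     point. *)
  have [i1|i1] := ltnP i.+1 m; have [j1|j1] := ltnP j.+1 n.
  - by exfalso; have := h i1 j1; rewrite u0 v0; lra.
  - by right; apply/eqP; rewrite eqn_leq j1 ltn_ord.
  - by left; apply/eqP; rewrite eqn_leq i1 ltn_ord.
  - by left; apply/eqP; rewrite eqn_leq i1 ltn_ord.
have cu := cap_gt0 u0; have cv := cap_gt0 v0.
case=> [hu|hv].
  (* The exterior inequality and the upper bound of strip i are compatible only if thresholds 0 and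
     i coincide. *)
  have [i0 uE] : i = 0%N :> nat /\ u p = tau m i * cap (v p).
    have /andP[_ h2] := si.
    have := le_trans hu h2; rewrite ler_pM2r // => t0i.
    have i0 : i = 0%N :> nat.
      apply/eqP; rewrite -leqn0 leqNgt; apply/negP => i0.
      by have := tau_lt (R := R) i0 (ltnW (ltn_ord i)); lra.
    by split=> //; apply/eqP; rewrite eq_le h2 i0.
  have De : ~~ D (inl (i, j)) by apply: (undrawn_arc dp); apply/edge_arcP.
  by have := undrawn_connect De; rewrite /=; case: opredP => //= i'; rewrite i0.
have [j0 vE] : j = 0%N :> nat /\ v p = tau n j * cap (u p).
  have /andP[_ h2] := sj.
  have := le_trans hv h2; rewrite ler_pM2r // => t0j.
  have j0 : j = 0%N :> nat.
    apply/eqP; rewrite -leqn0 leqNgt; apply/negP => j0.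
    by have := tau_lt (R := R) j0 (ltnW (ltn_ord j)); lra.
  by split=> //; apply/eqP; rewrite eq_le h2 j0.
have De : ~~ D (inr (i, j)) by apply: (undrawn_arc dp); apply/edge_arcP.
by have := undrawn_connect De; rewrite /=; case: opredP => //= j'; rewrite j0.
Qed.

(** Two bounded cells meeting at the outer point are joined through the exterior; elsewhere they are
    joined through (i', j), which also contains p. *)
Lemma cell_set_connect c c' p : ~ drawn p -> cell_set c p -> cell_set c' p -> con c c'.
Proof.
move=> dp; case: c c' => [[i j]|] [[i' j']|] cp c'p; last exact: connect0.
- have [si sj _] := cp; have [si' sj' _] := c'p.
  have [[u0 v0]|[u0 v0]] := strip_pos (ltn_ord i) (ltn_ord j) si sj.
    have O : @cell_set R m n None p.
      left; rewrite u0 v0; have [[? ->]|[]] := capP (0 : R); rewrite ?mulr0 //; lra.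
    apply: (@connect_trans _ _ None); last exact: cell_exterior_adj c'p O.
    by rewrite undrawn_adj_sym; exact: cell_exterior_adj cp O.
  apply: connect_trans (strip_adj_row u0 v0 dp si si' sj) _.
  exact: strip_adj_col u0 v0 dp si' sj sj'.
- by rewrite undrawn_adj_sym; exact: cell_exterior_adj cp c'p.
- exact: cell_exterior_adj c'p cp.
Qed.

Lemma cell_set_center c : cell_set c (@center R m n c).
Proof.
have := open_cell_center c; case: c => [[i j] [/andP[? ?] /andP[? ?]]|[?|?]].
- split; try by apply/andP; split; exact: ltW.
  by move=> _ _; rewrite /ucoord /vcoord /= !subKr; have := ctr_ge1 (R := R) m i;
    have := ctr_ge1 (R := R) n j; lra.
- by left; exact: ltW.
- by right; exact: ltW.
Qed.

(** The cells in the class of c and the other cells have closed unions that meet only on the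
    drawing, so a connected set avoiding the drawing stays in one of them. *)
Lemma component_cells c : comp (center c) `<=`
  \bigcup_(c' in [set c' | con c c']) @cell_set R m n c'.
Proof.
have dc c' : ~ drawn (center c') by apply: open_cell_undrawn (open_cell_center _).
apply: (@connected_closed_cover _ _ _
    (\bigcup_(c' in [set c' | ~~ con c c']) @cell_set R m n c')).
- exact: component_connected.
- by apply: closed_bigcup => [|c' _]; [exact: finite_finset | exact: closed_cell_set].
- by apply: closed_bigcup => [|c' _]; [exact: finite_finset | exact: closed_cell_set].
- move=> p _; have [c' c'p] := cell_set_cover m_gt0 n_gt0 p.
  by have [cc'|cc'] := boolP (con c c'); [left|right]; exists c'.
- apply/seteqP; split=> // p.
  move=> [[/connected_component_sub dp [c1 cc1 c1p]]] [c2 /negP cc2 c2p].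
  by apply: cc2; apply: connect_trans cc1 (cell_set_connect dp c1p c2p).
- exists (center c); split; first by apply: connected_component_refl; exact: dc.
  by exists c; [exact: connect0 | exact: cell_set_center].
Qed.

Lemma component_center_inj c c' : comp (center c) = comp (center c') -> con c c'.
Proof.
have dc c1 : ~ drawn (center c1) by apply: open_cell_undrawn (open_cell_center _).
move=> E; have : comp (center c) (center c').
  by rewrite E; apply: connected_component_refl; exact: dc.
move=> /component_cells[c1 /= cc1 c1p]; apply: connect_trans cc1 _.
exact: cell_set_connect (dc c') c1p (cell_set_center c').
Qed.

Lemma bounded_componentP c : bounded_set (comp (center c)) <-> ~~ con None c.
Proof.
split=> [[M [Mreal bM]]|Nc].
  apply/negP => /connect_component E; rewrite -E in bM.
  pose M1 := Num.max M 0 + 1.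
  have MM1 : M < M1 by rewrite /M1 ltr_pwDr // le_max lexx.
  have M10 : 1 <= M1 by rewrite /M1 lerDr le_max lexx orbT.
  (* A point of the exterior whose norm, the maximum of the coordinates in absolute value, exceeds
     M. *)
  pose q : plane := (- 1 - M1, - 1 - M1).
  have uc : u (@center R m n None) = m.+1%:R + 1 by rewrite /ucoord /=; lra.
  have uq : u q = m.+1%:R + 1 + M1 by rewrite /ucoord /=; lra.
  have tm : tau m 0 = m.+1%:R :> R by rewrite tau_nat // subr0.
  have cap_le1 (t : R) : cap t <= 1 by have [[? ->]|[? ->]] := capP t.
  have M0 : 0 < m.+1%:R :> R by rewrite ltr0n.
  have dq : ~ drawn q.
    by apply: (@open_cell_undrawn None); left; rewrite tm uq; have := cap_le1 (v q); nra.
  have cq : comp (@center R m n None) q.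
    rewrite -(@cell_component None q) //; first exact: connected_component_refl.
    by left; rewrite tm uq; have := cap_le1 (v q); nra.
  have := bM _ MM1 q cq; apply/negP; rewrite -ltNge.
  rewrite [X in _ < X](_ : _ = Num.max `|q.1| `|q.2|) // lt_max; apply/orP; left.
  by rewrite /q /= ler0_norm; lra.
(* A crude bound: points of bounded cells have coordinates in [0, m + 1] and [0, n + 1]. *)
exists (m.+1%:R + n.+1%:R + m.+1%:R + n.+1%:R); split; first exact: num_real.
move=> M hM p /component_cells[[[i j]|] /= cc]; last first.
  by rewrite undrawn_adj_sym cc in Nc.
move=> [si sj _].
have := strip_cap (ltn_ord i) si; have := strip_cap (ltn_ord j) sj.
have cap_le1 (t : R) : cap t <= 1 by have [[? ->]|[? ->]] := capP t.
have tle k (l : 'I_k) : tau k l <= k.+1%:R :> R.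
  by rewrite tau_nat // lerBlDr lerDl.
case/andP: si => _ su; case/andP: sj => _ sv u0 v0.
have M0 : 0 < m.+1%:R :> R by rewrite ltr0n.
have N0 : 0 < n.+1%:R :> R by rewrite ltr0n.
have u1 : u p <= m.+1%:R.
  by have := tle _ i; have := tau_ge0 (R := R) m i; have := cap_le1 (v p); nra.
have v1 : v p <= n.+1%:R.
  by have := tle _ j; have := tau_ge0 (R := R) n j; have := cap_le1 (u p); nra.
rewrite [X in X <= _](_ : _ = Num.max `|p.1| `|p.2|) // ge_max.
rewrite /ucoord /vcoord in u0 v0 u1 v1.
by rewrite !ger0_norm; lra.
Qed.

Lemma regions_image d : (forall e, D e <-> d e = [set 0; 1]) ->
  @regions R m n d = [set` [fset comp (center c) | c in bounded_classes D]%fset].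
Proof.
move=> Dd; have dE : drawing d = drawn.
  by apply/seteqP; split=> p [e /= /Dd De ep]; exists e.
rewrite /regions dE; apply/seteqP; split=> C /=.
  move=> [[p dp ->]]; have [c cp] := cell_set_cover m_gt0 n_gt0 p.
  rewrite (cell_component cp dp) => /bounded_componentP bc.
  apply/imfsetP; exists (fingraph.root (undrawn_adj D) c).
    exact: bounded_class_root.
  exact/connect_component/connect_root.
move=> /imfsetP[c /=]; rewrite inE => /andP[_ bc] ->; split.
  by exists (center c) => //; apply: open_cell_undrawn (open_cell_center _).
exact/bounded_componentP.
Qed.

(** Distinct representatives are not connected, so their centres lie in distinct components. *)
Lemma card_regions d : (forall e, D e <-> d e = [set 0; 1]) ->
  finite_set (@regions R m n d) /\
  #|` fset_set (@regions R m n d)| = #|bounded_classes D|.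
Proof.
move=> /regions_image ->; split; first exact: finite_fset.
rewrite set_fsetK card_in_imfset /= ?cardE //.
move=> c c'; rewrite !inE => /andP[/eqP rc _] /andP[/eqP rc' _].
by move=> /component_center_inj /(fingraph.rootP (undrawn_adj_sym D)); rewrite rc rc'.
Qed.

End Regions.

(** * The face lattice *)

Section FaceLattice.
Context {R : realType} {m n : nat}.
Hypotheses (m_gt0 : (0 < m)%N) (n_gt0 : (0 < n)%N).
Implicit Types (F MM : set 'M[R]_(m, n)).
Local Notation pasms := [set M : 'M[R]_(m, n) | pasm M].

(* If there were no edge, all sets of matrices would have the same labeling. *)
Let e0 : edge m n := inl (Ordinal m_gt0, Ordinal n_gt0).

Lemma labeling_of_eq0 MM : labeling_of MM = empty_labeling <-> MM = set0.
Proof.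
split=> [E|->]; last by apply/funext => e; exact: bigcup_set0.
apply/seteqP; split=> // M MMM.
suff : labeling_of MM e0 (edge_sum e0 M) by rewrite E.
by apply/labeling_ofE; exists M.
Qed.

(** Over the empty set both 0 and 1 are fixed values at [e0], which no point satisfies. *)
Lemma agree_neq0 MM x : agree MM x -> MM !=set0.
Proof.
move=> ax; apply/set0P/negP => /eqP MM0.
have a01 a : edge_sum e0 x = a by apply: ax => M; rewrite MM0.
by have := a01 0; rewrite (a01 1) => /eqP; rewrite oner_eq0.
Qed.

(** A face, the empty one included, is recovered from the edges fixed on its PASMs, hence from its
    labeling. *)
Lemma faceE F : face (@box R m n) F -> F = box `&` agree (pasms `&` F).
Proof.
move=> Ff; apply/seteqP; split=> x.
  by move=> Fx; split; [exact: face_sub Fx | exact: face_sub_agree].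
by move=> [bx ax]; apply: agree_sub_face => //; exact: agree_neq0 ax.
Qed.

Lemma psi_face F : face (@box R m n) F -> psi F = labeling_of (pasms `&` F).
Proof. by move=> Ff; rewrite /psi pasm_vertices_face. Qed.

Lemma psi_le F F' : face (@box R m n) F -> face (@box R m n) F' ->
  (F `<=` F' <-> labeling_sub (psi F) (psi F')).
Proof.
move=> Ff Ff'; rewrite !psi_face //; split=> [FF' e a|].
  by move=> /labeling_ofE[M [pM /FF' FM]] <-; apply/labeling_ofE; exists M.
move=> /agree_labeling_sub sub; rewrite (faceE Ff) (faceE Ff') => x [bx /sub].
by split.
Qed.

Lemma sum_labeling_psi F : face (@box R m n) F -> sum_labeling (psi F).
Proof.
move=> Ff; rewrite psi_face //.
have [E|/set0P MM0] := eqVneq (pasms `&` F) set0.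
  by left; apply/labeling_of_eq0.
by right; exists (pasms `&` F); split=> //; exact: subIsetl.
Qed.

Lemma psi_surj (d : labeling R m n) : sum_labeling d ->
  exists2 F, face (@box R m n) F & psi F = d.
Proof.
case=> [->|[MM [MM0 MMp ->]]].
  have f0 : face (@box R m n) set0.
    (* The zero functional never reaches the bound 1, which cuts out the empty face. *)
    exists 0, 1; have dot0 x : mxdot (0 : 'M[R]_(m, n)) x = 0.
      by rewrite /mxdot big1 // => i _; rewrite big1 // => j _; rewrite mxE mul0r.
    split=> [x _|]; first by rewrite dot0 ler01.
    apply/seteqP; split=> // x [_ /=]; rewrite dot0 => /eqP.
    by rewrite eq_sym oner_eq0.
  by exists set0 => //; rewrite psi_face // setI0; apply/labeling_of_eq0.
have Ff := face_agree MMp MM0.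
by exists (box `&` agree MM) => //; rewrite psi_face // labeling_of_agree.
Qed.

Lemma affine_dim0 : affine_dim (set0 : set 'M[R]_(m, n)) = -1.
Proof.
rewrite /affine_dim big1 // => k /asboolP[x [_ Fx]].
by case: k x Fx => [[|k] kn] // x /(_ ord0).
Qed.

Lemma free_labelP MM e : MM `<=` pasms ->
  free MM e <-> labeling_of MM e = [set 0; 1].
Proof.
move=> MMp; split=> [ef|E [a ea]].
  apply/seteqP; split=> a.
    by move=> /labeling_ofE[M /MMp /(pasm01 e)[[] ->] <-]; [right | left].
  case=> ->; apply/labeling_ofE.
    by have [M MMM eM] := free01 false MMp ef; exists M.
  by have [M MMM eM] := free01 true MMp ef; exists M.
have /labeling_ofE[M MMM e_0] : labeling_of MM e 0 by rewrite E; left.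
have /labeling_ofE[M' MMM' e_1] : labeling_of MM e 1 by rewrite E; right.
by move: (oner_neq0 R); rewrite -e_1 -e_0 (ea _ MMM) (ea _ MMM') eqxx.
Qed.

Lemma affine_dim_face F : face (@box R m n) F ->
  finite_set (regions (psi F)) /\ affine_dim F = num_regions (psi F).
Proof.
move=> Ff; rewrite psi_face //; set MM := pasms `&` F.
have MMp : MM `<=` pasms := @subIsetl _ _ _.
have [fin card] := @card_regions R m n m_gt0 n_gt0 (fun e => `[< free MM e >])
  (labeling_of MM) (fun e => iff_trans (iff_sym (rwP (asboolP _))) (free_labelP e MMp)).
split=> //; rewrite /num_regions; case: asboolP => [/labeling_of_eq0 E|NE].
  (* Without PASMs the face is empty, and both sides are -1. *)
  suff -> : F = set0 by exact: affine_dim0.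
  apply/seteqP; split=> // x; rewrite (faceE Ff) => -[_ /agree_neq0].
  by rewrite -/MM E => -[].
have MM0 : MM !=set0 by apply/set0P/eqP => MM0; apply/NE/labeling_of_eq0.
by rewrite card {1}(faceE Ff) affine_dim_agree.
Qed.

End FaceLattice.

Theorem theorem4p17 (R : realType) (m n : nat) (m_gt0 : (0 < m)%N)
    (n_gt0 : (0 < n)%N) :
  [/\ set_bij [set F | face (PASM R m n) F]
              [set d : labeling R m n | sum_labeling d] psi,
      (forall F F' : set 'M[R]_(m, n),
         face (PASM R m n) F -> face (PASM R m n) F' ->
         (F `<=` F' <-> labeling_sub (psi F) (psi F'))) &
      (forall F : set 'M[R]_(m, n), face (PASM R m n) F ->
         finite_set (regions (psi F)) /\
         affine_dim F = num_regions (psi F))].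
Proof.
rewrite PASM_box; split; [split| |].
- by move=> F /= Ff; exact: sum_labeling_psi.
(* Injectivity follows from the order equivalence by antisymmetry of inclusion. *)
- move=> F F' /set_mem Ff /set_mem Ff' E; apply/seteqP; split.
    by apply/(psi_le m_gt0 n_gt0 Ff Ff'); rewrite E => e.
  by apply/(psi_le m_gt0 n_gt0 Ff' Ff); rewrite E => e.
- by move=> d /(psi_surj m_gt0 n_gt0)[F Ff <-]; exists F.
- by move=> F F'; exact: psi_le.
- by move=> F; exact: affine_dim_face.
Qed.
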